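(* Let $S\subset[1,\infty)$ be an increasing sequence. The space \[ \mathcal U:=\bigcap_{p\in S}L^p, \] endowed with the locally convex topology generated by the norms $\|\cdot\|_{L^p}$, $p\in S$, is a Fréchet space, and its topological dual may be identified with \[ \mathcal Y:=\bigcup_{p\in S}L^{p'},\qquad \tfrac1p+\tfrac1{p'}=1\quad(p'=\infty\text{ if }p=1), \] under the bilinear form $\langle u,y\rangle=E[u\cdot y]$.
   Context: $(\Omega,\mathcal F,P)$ is a probability space and $L^p=L^p(\Omega,\mathcal F,P;\mathbb R^n)$ is the usual Lebesgue space of $\mathbb R^n$-valued random variables, $n\ge1$; $E$ denotes expectation. The identification means that the continuous linear functionals on $\mathcal U$ are exactly those of the form $u\mapsto E[u\cdot y]$ with $y\in\mathcal Y$, and $y$ is uniquely determined by the functional. *)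

(* Defs.v *)
From HB Require Import structures.
From mathcomp Require Import all_boot all_order all_algebra.
From mathcomp Require Import ring lra.
From mathcomp Require Import all_classical all_reals all_analysis.
From mathcomp Require Import measurable_realfun.

Set Implicit Arguments.
Unset Strict Implicit.
Unset Printing Implicit Defensive.

Import Order.TTheory GRing.Theory Num.Theory.
Import numFieldNormedType.Exports.

Local Open Scope classical_set_scope.
Local Open Scope ring_scope.
Local Open Scope quotient_scope.

Section euclidean.
Context (R : realType) (n : nat).
Implicit Types x y : 'rV[R]_n.

Definition dotp x y : R := \sum_(i < n) x 0 i * y 0 i.

(* The library norm on ['rV[R]_n] is the sup norm. *)
Definition enorm x : R := Num.sqrt (dotp x x).

Lemma dotpC x y : dotp x y = dotp y x.
Proof. by apply: eq_bigr => i _; rewrite mulrC. Qed.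

Lemma dotpDl x y z : dotp (x + y) z = dotp x z + dotp y z.
Proof. by rewrite -big_split; apply: eq_bigr => i _; rewrite mxE mulrDl. Qed.

Lemma dotpZl a x y : dotp (a *: x) y = a * dotp x y.
Proof. by rewrite mulr_sumr; apply: eq_bigr => i _; rewrite mxE mulrA. Qed.

Lemma dotp_ge0 x : 0 <= dotp x x.
Proof. by apply: sumr_ge0 => i _; rewrite -expr2 sqr_ge0. Qed.

Lemma enorm_ge0 x : 0 <= enorm x. Proof. exact: sqrtr_ge0. Qed.

Lemma enorm_sqr x : enorm x ^+ 2 = dotp x x.
Proof. exact/sqr_sqrtr/dotp_ge0. Qed.

Lemma enormZ a x : enorm (a *: x) = `|a| * enorm x.
Proof.
by rewrite /enorm dotpZl dotpC dotpZl mulrA -expr2 sqrtrM ?sqr_ge0// sqrtr_sqr.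
Qed.

Lemma enorm0 : enorm 0 = 0.
Proof. by rewrite -(scale0r 0) enormZ normr0 mul0r. Qed.

Lemma dotp_le x y : dotp x y <= enorm x * enorm y.
Proof.
have [y0|y0] := eqVneq (enorm y) 0.
  suff -> : y = 0.
    rewrite enorm0 mulr0 dotpC; rewrite -(scale0r (0 : 'rV_n)) dotpZl mul0r.
    exact: lexx.
  have : dotp y y = 0 by rewrite -enorm_sqr y0 expr0n.
  move=> /eqP; rewrite psumr_eq0; last by move=> i _; rewrite -expr2 sqr_ge0.
  move=> /allP h; apply/rowP => i; rewrite mxE; apply/eqP.
  have := h i; rewrite mem_index_enum => /(_ isT) /=.
  by rewrite mulf_eq0 orbb.
have [x0|x0] := eqVneq (enorm x) 0.
  suff -> : x = 0.
    rewrite enorm0 mul0r; rewrite -(scale0r (0 : 'rV_n)) dotpZl mul0r.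
    exact: lexx.
  have : dotp x x = 0 by rewrite -enorm_sqr x0 expr0n.
  move=> /eqP; rewrite psumr_eq0; last by move=> i _; rewrite -expr2 sqr_ge0.
  move=> /allP h; apply/rowP => i; rewrite mxE; apply/eqP.
  have := h i; rewrite mem_index_enum => /(_ isT) /=.
  by rewrite mulf_eq0 orbb.
have xy0 : 0 < enorm x * enorm y by rewrite mulr_gt0// lt0r ?x0 ?y0 enorm_ge0.
have := dotp_ge0 (enorm y *: x + (- enorm x) *: y).
rewrite dotpDl !dotpZl ![dotp _ (_ + _)]dotpC !dotpDl !dotpZl.
rewrite (dotpC y x) -!enorm_sqr => h.
rewrite -subr_ge0 -(pmulr_rge0 _ xy0) -(pmulr_rge0 _ (ltr0Sn R 1)).
apply: le_trans h _; rewrite le_eqVlt; apply/orP; left; apply/eqP; ring.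
Qed.

Lemma enormD x y : enorm (x + y) <= enorm x + enorm y.
Proof.
rewrite -(@ler_pXn2r _ 2)// ?nnegrE ?addr_ge0 ?enorm_ge0//.
rewrite enorm_sqr dotpDl ![dotp _ (_ + _)]dotpC !dotpDl (dotpC y x).
have := dotp_le x y; rewrite sqrrD !enorm_sqr; lra.
Qed.

End euclidean.

Section random_vectors.
Context d (T : measurableType d) (R : realType) (P : probability T R) (n : nat).

(* ['rV[R]_n] carries no sigma-algebra in the library; measurability for the
   product (= Borel) one is measurability of the coordinates. *)
Definition random_vector : {pred T -> 'rV[R]_n} :=
  mem [set u : T -> 'rV[R]_n | forall i, measurable_fun setT (fun w => u w 0 i)].

Lemma random_vectorP (u : T -> 'rV[R]_n) :
  u \in random_vector <-> forall i, measurable_fun setT (fun w => u w 0 i).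
Proof. by split; rewrite inE. Qed.

Lemma random_vector_submod : submod_closed random_vector.
Proof.
split.
  apply/random_vectorP => i; rewrite (_ : (fun w => _) = cst 0)//.
  by apply/funext => w; rewrite mxE.
move=> a u v /random_vectorP mu /random_vectorP mv; apply/random_vectorP => i.
rewrite (_ : (fun w => _) = (fun w => a * u w 0 i + v w 0 i)); last first.
  by apply/funext => w; rewrite !mxE.
by apply: measurable_funD => //; apply: measurable_funM.
Qed.

HB.instance Definition _ :=
  GRing.isSubmodClosed.Build R _ random_vector random_vector_submod.

Record RV := mkRV { RV_fun :> T -> 'rV[R]_n ; RV_measurable : RV_fun \in random_vector }.

HB.instance Definition _ := [isSub for RV_fun].
HB.instance Definition _ := [Choice of RV by <:].
HB.instance Definition _ := [SubChoice_isSubLmodule of RV by <:].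

Definition ae_eq_RV (u v : RV) := `[< (u : T -> _) = v %[ae P] >].

Let ae_eq_RV_refl : reflexive ae_eq_RV.
Proof. by move=> u; apply/asboolP; exact: ae_eq_refl. Qed.

Let ae_eq_RV_sym : symmetric ae_eq_RV.
Proof. by move=> u v; apply/idP/idP => /asboolP h; apply/asboolP/ae_eq_sym. Qed.

Let ae_eq_RV_trans : transitive ae_eq_RV.
Proof.
by move=> u v w /asboolP vu /asboolP uw; apply/asboolP/(ae_eq_trans vu uw).
Qed.

Canonical ae_eq_RV_equiv :=
  EquivRel ae_eq_RV ae_eq_RV_refl ae_eq_RV_sym ae_eq_RV_trans.

Definition L0 : Type := {eq_quot ae_eq_RV}.
HB.instance Definition _ := Choice.on L0.
HB.instance Definition _ := EqQuotient.on L0.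

(* [x : L0] coerces to an arbitrary representative, determined up to a null
   set. *)
Definition L0_fun (x : L0) : T -> 'rV[R]_n := RV_fun (repr x).
Coercion L0_fun : L0 >-> Funclass.

Lemma L0P (u v : RV) : ae_eq_RV u v -> \pi_L0 u = \pi_L0 v.
Proof. by move=> uv; apply/eqmodP. Qed.

Lemma L0_funP (x : L0) i : measurable_fun setT (fun w => x w 0 i).
Proof. by have /random_vectorP := RV_measurable (repr x); exact. Qed.

Lemma L0_pi (u : RV) : L0_fun (\pi_L0 u) = u %[ae P].
Proof. by apply/asboolP; have /eqmodP := reprK (\pi_L0 u). Qed.

Definition L0_zero : L0 := \pi_L0 0.
Definition L0_opp (x : L0) : L0 := \pi_L0 (- repr x).
Definition L0_add (x y : L0) : L0 := \pi_L0 (repr x + repr y).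
Definition L0_scale (a : R) (x : L0) : L0 := \pi_L0 (a *: repr x).

Lemma pi_RVD (u v : RV) : L0_add (\pi_L0 u) (\pi_L0 v) = \pi_L0 (u + v).
Proof.
apply/L0P/asboolP; have := L0_pi v; have := L0_pi u.
by apply: filterS2 => w /(_ I) hu /(_ I) hv _; congr (_ + _).
Qed.

Lemma pi_RVN (u : RV) : L0_opp (\pi_L0 u) = \pi_L0 (- u).
Proof.
apply/L0P/asboolP; have := L0_pi u.
by apply: filterS => w /(_ I) hu _; exact: (congr1 -%R hu).
Qed.

Lemma pi_RVZ a (u : RV) : L0_scale a (\pi_L0 u) = \pi_L0 (a *: u).
Proof.
apply/L0P/asboolP; have := L0_pi u.
by apply: filterS => w /(_ I) hu _; exact: (congr1 ( *:%R a) hu).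
Qed.

Let L0_addA : associative L0_add.
Proof.
move=> x y z; rewrite -(reprK x) -(reprK y) -(reprK z).
rewrite (pi_RVD (repr y) (repr z)) (pi_RVD (repr x) (repr y)).
by rewrite (pi_RVD (repr x)) (pi_RVD _ (repr z)) addrA.
Qed.

Let L0_addC : commutative L0_add.
Proof.
move=> x y; rewrite -(reprK x) -(reprK y).
by rewrite (pi_RVD (repr x)) (pi_RVD (repr y)) addrC.
Qed.

Let L0_add0 : left_id L0_zero L0_add.
Proof. by move=> x; rewrite -(reprK x) pi_RVD add0r. Qed.

Let L0_addN : left_inverse L0_zero L0_opp L0_add.
Proof. by move=> x; rewrite -(reprK x) pi_RVN pi_RVD addNr. Qed.

HB.instance Definition _ :=
  GRing.isZmodule.Build L0 L0_addA L0_addC L0_add0 L0_addN.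

Let L0_scaleA a b x : L0_scale a (L0_scale b x) = L0_scale (a * b) x.
Proof.
rewrite -(reprK x) (pi_RVZ b) (pi_RVZ a (b *: repr x)).
by rewrite (pi_RVZ (a * b)) scalerA.
Qed.

Let L0_scale1 : left_id 1 L0_scale.
Proof. by move=> x; rewrite -(reprK x) pi_RVZ scale1r. Qed.

Let L0_scaleDr : right_distributive L0_scale +%R.
Proof.
move=> a x y; rewrite -(reprK x) -(reprK y).
transitivity (L0_scale a (\pi_L0 (repr x + repr y))).
  by congr L0_scale; exact: pi_RVD.
rewrite (pi_RVZ a (repr x)) (pi_RVZ a (repr y)) (pi_RVZ a) scalerDr.
by apply/esym; exact: pi_RVD.
Qed.

Let L0_scaleDl x : {morph L0_scale^~ x : a b / a + b}.
Proof.
move=> a b; rewrite -(reprK x).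
rewrite (pi_RVZ (a + b)) (pi_RVZ a (repr x)) (pi_RVZ b (repr x)) scalerDl.
by apply/esym; exact: pi_RVD.
Qed.

HB.instance Definition _ := GRing.Zmodule_isLmodule.Build R L0
  L0_scaleA L0_scale1 L0_scaleDr L0_scaleDl.

Lemma L0D (x y : L0) : L0_fun (x + y) = (fun w => x w + y w) %[ae P].
Proof. exact: L0_pi. Qed.

Lemma L0Z a (x : L0) : L0_fun (a *: x) = (fun w => a *: x w) %[ae P].
Proof. exact: L0_pi. Qed.

Lemma L0_0 : L0_fun 0 = (fun=> 0) %[ae P].
Proof. exact: L0_pi. Qed.

Lemma measurable_dotp (u v : L0) :
  measurable_fun setT (fun w => dotp (u w) (v w)).
Proof.
by apply: measurable_sum => i; apply: measurable_funM; exact: L0_funP.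
Qed.

Lemma measurable_enorm (u : L0) : measurable_fun setT (fun w => enorm (u w)).
Proof.
rewrite (_ : (fun w => _) = (fun w => (dotp (u w) (u w)) `^ 2^-1)).
  exact/(measurableT_comp (measurable_powR _))/measurable_dotp.
by apply/funext => w; rewrite powR12_sqrt// dotp_ge0.
Qed.

(* For [p = +oo], ['N[P]_p] is the essential supremum. *)
Definition Lpnorm (p : \bar R) (x : L0) : \bar R :=
  'N[P]_p[EFin \o (fun w => enorm (x w))]%E.

Definition Lp (p : \bar R) : set L0 := [set x | (Lpnorm p x < +oo)%E].

Lemma le_Lnorm (f g : T -> R) (q : R) : (0 < q) ->
  measurable_fun setT f -> measurable_fun setT g ->
  (\forall w \ae P, 0 <= f w <= g w) ->
  ('N[P]_q%:E[EFin \o f] <= 'N[P]_q%:E[EFin \o g])%E.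
Proof.
move=> q0 mf mg fg; rewrite unlock /Lnorm.
have m (h : T -> R) : measurable_fun setT h ->
    measurable_fun setT (fun w => (`|(EFin \o h) w| `^ q)%E : \bar R).
  move=> mh; apply/measurable_EFinP.
  apply: (measurableT_comp (measurable_powR _)).
  exact: measurableT_comp.
have I (h : T -> R) : (0 <= \int[P]_w `|(EFin \o h) w| `^ q)%E.
  by apply: integral_ge0 => w _; exact: poweR_ge0.
apply: gt0_ler_poweR.
- by rewrite invr_ge0 ltW.
- by rewrite in_itv/= leey andbT; exact: I.
- by rewrite in_itv/= leey andbT; exact: I.
apply: ae_ge0_le_integral => //.
- by move=> w _; exact: poweR_ge0.
- exact: m.
- by move=> w _; exact: poweR_ge0.
- exact: m.
apply: filterS fg => w /andP[f0 fg] _; rewrite /= lee_fin.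
apply: ge0_ler_powR; rewrite ?nnegrE ?(ltW q0)//.
by rewrite !ger0_norm// (le_trans f0).
Qed.

Lemma LpnormD (q : R) (x y : L0) : 1 <= q ->
  (Lpnorm q%:E (x + y)%R <= Lpnorm q%:E x + Lpnorm q%:E y)%E.
Proof.
move=> q1; pose g w := enorm (x w) + enorm (y w).
apply: (@le_trans _ _ ('N[P]_q%:E[EFin \o g])%E).
  apply: le_Lnorm; [exact: lt_le_trans q1|exact: measurable_enorm| |].
    by apply: measurable_funD; exact: measurable_enorm.
  by have := L0D x y; apply: filterS => w /(_ I) ->; rewrite enorm_ge0 enormD.
by apply: eminkowski; rewrite ?lee_fin//; exact: measurable_enorm.
Qed.

Lemma LpnormZ (q : R) a (x : L0) : 1 <= q -> Lp q%:E x ->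
  Lpnorm q%:E (a *: x) = (`|a|%:E * Lpnorm q%:E x)%E.
Proof.
move=> q1 xq.
have xL : (fun w => enorm (x w)) \in Lfun P q%:E.
  by rewrite inE; apply/andP; split; rewrite inE//=; exact: measurable_enorm.
have q1' : (1 <= q%:E)%E by rewrite lee_fin.
have := @LnormZ _ _ _ P _ q1' (Lfun_Sub q1' xL) `|a|.
rewrite normr_id => <-.
have q0 : 0 < q by exact: lt_le_trans q1.
have mr : measurable_fun setT (`|a| \*: Lfun_Sub q1' xL : T -> R).
  by apply: measurable_funM => //; exact: measurable_enorm.
apply/eqP; rewrite eq_le; apply/andP; split; apply: le_Lnorm => //.
- exact: measurable_enorm.
- have := L0Z a x; apply: filterS => w /(_ I) ->.
  by rewrite enorm_ge0/= enormZ lexx.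
- exact: measurable_enorm.
- have := L0Z a x; apply: filterS => w /(_ I) ->.
  by rewrite enormZ lexx andbT mulr_ge0// enorm_ge0.
Qed.

Lemma Lpnorm0 (q : R) : 1 <= q -> Lpnorm q%:E 0 = 0%E.
Proof.
move=> q1; have q0 : 0 < q by exact: lt_le_trans q1.
apply/eqP; rewrite eq_le Lnorm_ge0 andbT.
have <- : ('N[P]_q%:E[EFin \o cst 0%R] = 0)%E by rewrite Lnorm0// gt_eqF.
apply: le_Lnorm => //; first exact: measurable_enorm.
by have := L0_0; apply: filterS => w /(_ I) ->; rewrite enorm0 lexx.
Qed.

Lemma Lp_submod (q : R) : 1 <= q ->
  Lp q%:E 0 /\ forall a x y, Lp q%:E x -> Lp q%:E y -> Lp q%:E (a *: x + y).
Proof.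
move=> q1; split; first by rewrite /Lp/= Lpnorm0.
move=> a x y xq yq; apply: le_lt_trans (LpnormD _ _ q1) _.
rewrite lte_add_pinfty// LpnormZ// lte_mul_pinfty// ge0_fin_numE//.
Qed.

End random_vectors.

Section seminorm_topology.
Context (R : realType) (V : lmodType R) (I : eqType) (D : set I).
Variable N : I -> V -> R.

(* A base of neighborhoods of [x] consists of the finite intersections of the
   balls [{y | N i (y - x) < e}], [i] in [D] and [e > 0]. *)
Definition seminorm_nbhs (x : V) : set_system V :=
  [set A | exists2 F : seq I, (forall i, i \in F -> D i) &
    exists2 e : R, 0 < e &
      [set y | forall i, i \in F -> N i (y - x) < e] `<=` A].

Hypothesis ND : forall i x y, D i -> N i (x + y) <= N i x + N i y.
Hypothesis NZ : forall i a x, D i -> N i (a *: x) = `|a| * N i x.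

Let N0 i : D i -> N i 0 = 0.
Proof. by move=> Di; rewrite -(scale0r 0) NZ// normr0 mul0r. Qed.

Let N_ge0 i x : D i -> 0 <= N i x.
Proof.
move=> Di; have := @ND i x (- x) Di.
by rewrite subrr N0// -scaleN1r NZ// normrN normr1 mul1r -mulr2n pmulrn_lge0.
Qed.

Lemma seminorm_nbhs_filter x : ProperFilter (seminorm_nbhs x).
Proof.
apply: Build_ProperFilter_ex.
  move=> A [F FD [e e0 FA]]; exists x; apply: FA => i iF.
  by rewrite subrr N0//; exact: FD.
split.
- by exists [::] => //; exists 1.
- move=> A B [F FD [e e0 FA]] [G GD [g g0 GB]].
  exists (F ++ G).
    by move=> i; rewrite mem_cat => /orP[/FD|/GD].
  exists (Num.min e g); first by rewrite lt_min e0.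
  move=> y h; split; [apply: FA => i iF|apply: GB => i iG].
    by have := h i; rewrite mem_cat iF => /(_ isT); rewrite lt_min => /andP[].
  by have := h i; rewrite mem_cat iG orbT => /(_ isT); rewrite lt_min => /andP[].
- move=> A B AB [F FD [e e0 FA]]; exists F => //; exists e => //.
  exact: subset_trans AB.
Qed.

Lemma seminorm_nbhs_singleton x A : seminorm_nbhs x A -> A x.
Proof.
move=> [F FD [e e0 FA]]; apply: FA => i iF.
by rewrite subrr N0//; exact: FD.
Qed.

Lemma seminorm_ball_nbhs (F : seq I) e x y : (forall i, i \in F -> D i) ->
  (forall i, i \in F -> N i (y - x) < e) ->
  seminorm_nbhs y [set z | forall i, i \in F -> N i (z - x) < e].
Proof.
move=> FD yx.
have [g g0 hg] : exists2 g, 0 < g & forall i, i \in F -> N i (y - x) + g <= e.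
  elim: F {FD} yx => [_|i F IH yx]; first by exists 1.
  have [|g g0 hg] := IH; first by move=> j jF; rewrite yx// inE jF orbT.
  exists (Num.min g (e - N i (y - x))).
    by rewrite lt_min g0 subr_gt0 yx// mem_head.
  move=> j; rewrite inE => /predU1P[->|jF].
    by rewrite -lerBrDl ge_min lexx orbT.
  by apply: le_trans (hg _ jF); rewrite lerD2l ge_min lexx.
exists F => //; exists g => // z zy i iF.
apply: lt_le_trans (hg _ iF).
rewrite -(subrKA y) addrC; apply: le_lt_trans (ND _ _ (FD _ iF)) _.
by rewrite ltrD2l; exact: zy.
Qed.

Lemma seminorm_nbhs_nbhs x A :
  seminorm_nbhs x A -> seminorm_nbhs x (seminorm_nbhs^~ A).
Proof.
move=> [F FD [e e0 FA]]; exists F => //; exists e => // y yx.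
have h := seminorm_ball_nbhs FD yx.
by apply: filterS h; have := seminorm_nbhs_filter y; case.
Qed.

Lemma seminorm_nbhs_add x y A : seminorm_nbhs (x + y) A ->
  exists B : set V * set V, [/\ seminorm_nbhs x B.1, seminorm_nbhs y B.2 &
    forall v w, B.1 v -> B.2 w -> A (v + w)].
Proof.
move=> [F FD [e e0 FA]].
pose B z := [set v | forall i, i \in F -> N i (v - z) < e / 2].
have e2 : 0 < e / 2 by rewrite divr_gt0.
exists (B x, B y); split => /=.
- by exists F => //; exists (e / 2).
- by exists F => //; exists (e / 2).
move=> v w vx wy; apply: FA => i iF.
rewrite opprD addrACA; apply: le_lt_trans (ND _ _ (FD _ iF)) _.
by rewrite (splitr e) ltrD// ?vx ?wy.
Qed.

Lemma seminorm_nbhs_scale (a : R) x A : seminorm_nbhs (a *: x) A ->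
  exists B : set R * set V, [/\ nbhs a B.1, seminorm_nbhs x B.2 &
    forall b v, B.1 b -> B.2 v -> A (b *: v)].
Proof.
move=> [F FD [e e0 FA]].
have [M M0 hM] : exists2 M, 0 < M & forall i, i \in F -> N i x <= M.
  elim: F FD {FA} => [_|i F IH FD]; first by exists 1.
  have [|M M0 hM] := IH; first by move=> j jF; apply: FD; rewrite inE jF orbT.
  exists (Num.max M (N i x)); first by rewrite lt_max M0.
  move=> j; rewrite inE => /predU1P[->|jF]; first by rewrite le_max lexx orbT.
  by rewrite le_max hM.
pose g := Num.min 1 (e / 2 / M).
pose h := e / 2 / (`|a| + 1).
have e2 : 0 < e / 2 by rewrite divr_gt0.
have a1 : 0 < `|a| + 1 by rewrite ltr_wpDl.
have g0 : 0 < g by rewrite lt_min ltr01 divr_gt0.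
have h0 : 0 < h by rewrite divr_gt0.
exists (ball a g, [set v | forall i, i \in F -> N i (v - x) < h]); split => /=.
- exact: nbhsx_ballx.
- by exists F => //; exists h.
move=> b v; rewrite /ball/= distrC => bg vx; apply: FA => i iF.
have Di := FD _ iF.
have -> : b *: v - a *: x = b *: (v - x) + (b - a) *: x.
  by rewrite scalerBr scalerBl addrA subrK.
apply: le_lt_trans (ND _ _ Di) _; rewrite !NZ//.
have bN : `|b| <= `|a| + 1.
  rewrite -(subrK a b) addrC (le_trans (ler_normD _ _))// lerD2l.
  by rewrite ltW// (lt_le_trans bg)// ge_min lexx.
rewrite (splitr e) ltr_leD//.
  rewrite (le_lt_trans (ler_wpM2r (N_ge0 _ Di) bN))//.
  by rewrite -ltr_pdivlMl// mulrC; exact: vx.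
apply: (@le_trans _ _ (g * M)).
  by rewrite ler_pM// ?N_ge0// ?hM// ltW.
by rewrite -ler_pdivlMr// ge_min lexx orbT.
Qed.

Lemma seminorm_ball_convex (F : seq I) e x : (forall i, i \in F -> D i) ->
  convex_set ([set y | forall i, i \in F -> N i (y - x) < e]
    : set (convex_lmodType V)).
Proof.
move=> FD; apply/convex_setW => y z /set_mem/= yx /set_mem/= zx k k0 k1.
apply/mem_set => /= i iF.
have Di := FD _ iF.
have -> : (conv k y z : V) - x =
    (k%:num : R) *: ((y : V) - x) + (1 - k%:num : R) *: ((z : V) - x).
  by rewrite !scalerBr addrACA -opprD -scalerDl subrKC scale1r.
have o0 : 0 < 1 - (k%:num : R) by rewrite subr_gt0.
apply: le_lt_trans (ND _ _ Di) _; rewrite !NZ// !gtr0_norm//.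
have -> : e = (k%:num : R) * e + (1 - k%:num) * e by ring.
by rewrite ltrD// ltr_pM2l// ?yx ?zx.
Qed.

End seminorm_topology.

Section intersection.
Context d (T : measurableType d) (R : realType) (P : probability T R) (n : nat).
Context (S : set R) (S1 : S `<=` `[1, +oo[).

Let S_ge1 q : S q -> 1 <= q.
Proof. by move=> /S1/=; rewrite in_itv/= andbT. Qed.

(* The hypothesis is a parameter only because the closure under addition, hence
   the module structure of the subtype [Uspace], depends on it. *)
Definition capL (_ : S `<=` `[1, +oo[) : {pred L0 P n} :=
  mem (\bigcap_(q in S) @Lp _ _ _ P n q%:E).

Lemma capLP (x : L0 P n) : x \in capL S1 <-> forall q, S q -> Lp q%:E x.
Proof. by split; rewrite inE. Qed.

Lemma capL_submod : submod_closed (capL S1).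
Proof.
split; first by apply/capLP => q /S_ge1 q1; exact: (Lp_submod P n q1).1.
move=> a x y /capLP xS /capLP yS; apply/capLP => q Sq.
by apply: (Lp_submod P n (S_ge1 Sq)).2; [exact: xS|exact: yS].
Qed.

HB.instance Definition _ :=
  GRing.isSubmodClosed.Build R _ (capL S1) capL_submod.

Record Uspace := mkUspace { Uval :> L0 P n ; UvalP : Uval \in capL S1 }.

HB.instance Definition _ := [isSub for Uval].
HB.instance Definition _ := [Choice of Uspace by <:].
HB.instance Definition _ := [SubChoice_isSubLmodule of Uspace by <:].

Definition Unorm (q : R) (u : Uspace) : R := fine (Lpnorm q%:E u).

Lemma Unorm_EFin q (u : Uspace) : S q -> (Unorm q u)%:E = Lpnorm q%:E u.
Proof.
move=> Sq; rewrite /Unorm fineK// ge0_fin_numE ?Lnorm_ge0//.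
by have /capLP := UvalP u; apply.
Qed.

Let UnormD q (u v : Uspace) : S q -> Unorm q (u + v) <= Unorm q u + Unorm q v.
Proof.
by move=> Sq; rewrite -lee_fin EFinD !Unorm_EFin//; exact/LpnormD/S_ge1.
Qed.

Let UnormZ q a (u : Uspace) : S q -> Unorm q (a *: u) = `|a| * Unorm q u.
Proof.
move=> Sq; apply: EFin_inj; rewrite EFinM !Unorm_EFin//.
by apply: LpnormZ; [exact: S_ge1|have /capLP := UvalP u; apply].
Qed.

HB.instance Definition _ := hasNbhs.Build Uspace (seminorm_nbhs S Unorm).

HB.instance Definition _ := Nbhs_isNbhsTopological.Build Uspace
  (seminorm_nbhs_filter UnormZ) (seminorm_nbhs_singleton UnormZ)
  (seminorm_nbhs_nbhs UnormD UnormZ).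

Let Uadd_continuous : continuous (fun x : Uspace * Uspace => x.1 + x.2).
Proof.
move=> [x y] A /= /(seminorm_nbhs_add UnormD)[[B C]] [/= xB yC BC].
by exists (B, C) => // -[v w] [/= Bv Cw]; exact: BC.
Qed.

Let Uscale_continuous : continuous (fun z : R^o * Uspace => z.1 *: z.2).
Proof.
move=> [a x] A /= /(seminorm_nbhs_scale UnormD UnormZ)[[B C]] [/= aB xC BC].
by exists (B, C) => // -[b w] [/= Bb Cw]; exact: BC.
Qed.

Let Ulocally_convex : exists2 B : set_system Uspace,
  (forall b, b \in B -> convex_set b) & basis B.
Proof.
exists [set b | exists F : seq R, exists e x, (forall i, i \in F -> S i) /\
    b = [set y | forall i, i \in F -> Unorm i (y - x) < e]].
  move=> b /[!inE]/= -[F [e [x [FS ->]]]].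
  exact: (seminorm_ball_convex UnormD UnormZ).
split.
  move=> b [F [e [x [FS ->]]]]; rewrite openE => y yx.
  exact: (seminorm_ball_nbhs UnormD).
move=> x A [F FS [e e0 FA]].
exists [set y | forall i, i \in F -> Unorm i (y - x) < e] => //.
split; first by exists F, e, x.
move=> i iF; rewrite subrr.
by rewrite -(scale0r 0) UnormZ ?normr0 ?mul0r//; exact: FS.
Qed.

(* This factory only provides the uniform structure. *)
HB.instance Definition _ := PreTopologicalLmod_isTvs.Build R Uspace
  Uadd_continuous Uscale_continuous Ulocally_convex.
HB.instance Definition _ :=
  PreTopologicalNmodule_isTopologicalNmodule.Build Uspace Uadd_continuous.
HB.instance Definition _ :=
  TopologicalNmodule_isTopologicalLmodule.Build R Uspace Uscale_continuous.
HB.instance Definition _ := Uniform_isTvs.Build R Uspace Ulocally_convex.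

End intersection.

Section duality.
Context d (T : measurableType d) (R : realType) (P : probability T R) (n : nat).

(* [hoelder_conjugate 1 = +oo] *)
Definition cupL (S : set R) : set (L0 P n) :=
  \bigcup_(q in S) @Lp _ _ _ P n (hoelder_conjugate q%:E).

(* Meaningful only when [dotp u y] is integrable ([fine] sends infinities to 0). *)
Definition pairing (u y : L0 P n) : R :=
  fine ('E_P[fun w => dotp (u w) (y w)])%E.

End duality.
Arguments cupL {d T R} P n S.

Definition topological_dual (R : realType) (E : tvsType R) : set (E -> R^o) :=
  [set f | linear f /\ continuous f].
Arguments topological_dual {R} E.

(* Local convexity is part of [tvsType]. The metric is translation-invariant, so
   its Cauchy sequences are those of the topological vector space. *)
Definition frechet_space (R : realType) (E : tvsType R) : Prop :=
  exists dist : E -> E -> R,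
    [/\ [/\ forall x y, dist x y = 0 <-> x = y,
            forall x y, dist x y = dist y x &
            forall x y z, dist x z <= dist x y + dist y z],
        forall x y z, dist (x + z) (y + z) = dist x y,
        forall x, nbhs x =
          filter_from [set e : R | 0 < e] (fun e => [set y | dist x y < e]) &
        forall u : nat -> E,
          (forall e : R, 0 < e -> exists N, forall i j, (N <= i)%N -> (N <= j)%N ->
            dist (u i) (u j) < e) ->
          exists l : E, u @ \oo --> l].

(* Main.v *)
From HB Require Import structures.
Require Import Defs.
From mathcomp Require Import all_boot all_order all_algebra.
From mathcomp Require Import ring lra.
From mathcomp Require Import all_classical all_reals all_analysis.
From mathcomp Require Import measurable_realfun ess_sup_inf.

Set Implicit Arguments.
Unset Strict Implicit.
Unset Printing Implicit Defensive.

Import Order.TTheory GRing.Theory Num.Theory.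
Import numFieldNormedType.Exports.

Local Open Scope classical_set_scope.
Local Open Scope ring_scope.

(** The countable family of norms gives an invariant metric.  A Cauchy sequence
has a subsequence with summable [L^1]-increments, which converges almost
everywhere; Fatou's lemma shows that its limit is the limit of the whole
sequence in each [L^p].

Since [P] is a probability, the norms increase with the exponent, so a
continuous functional [f] is bounded by [C * ||.||_q] for a single [q] in [S].
For each coordinate [i], [A |-> f (1_A e_i)] is a charge absolutely continuous
with respect to [P]; the Radon-Nikodym densities form a random vector [Y]
representing [f] on bounded functions.  Testing [f] on truncations of
[|Y|^(q'-2) Y] (on [Y / |Y|] where [|Y| > C] if [q = 1]) bounds [Y] in [L^q'],
and dominated convergence extends the representation to the whole space. *)

(** * Scalar [L^p] norms on a probability space *)

(** A functional on the intersection space only sees functions all of whose norms are finite, so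
    every approximation fed to it (indicators, simple functions, truncations) has to stay in that
    class and be dominated inside it. The difficulty is a circle. The formula f u = E[u . Y] needs u
    . Y to be integrable; when Y is produced it is only known to be in [L^1], and its bound in
    [L^q'] has to come from the formula itself. The representation is therefore first proved under
    the premise that the products u_i Y_i are integrable. For bounded u this holds because Y is
    integrable; bounded u suffice for the bound in [L^q']; Hölder's inequality then discharges the
    premise for every u. For q > 1 truncation does a second job: it makes I, the integral of |Y|^q'
    over |Y| <= m, finite a priori, so that I <= C I^(1/q) may be divided by I^(1/q). This leaves
    I^(1/q') <= C with the same C for all m. *)

Section scalar_norms.
Context d (T : measurableType d) (R : realType) (P : probability T R).
Implicit Types (f g h : T -> R) (p q : R).

Let measure_setT1 : (P : {measure set T -> \bar R}) setT = 1%E.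
Proof. exact: probability_setT. Qed.

Lemma measurable_norm_powR f q : measurable_fun setT f ->
  measurable_fun setT (fun w => `|f w| `^ q).
Proof.
move=> mf; apply: (measurableT_comp (measurable_powR _)).
exact: measurableT_comp.
Qed.

(** Raising to the power q is monotone both ways. This removes the root from the norm, so that
    Fatou's lemma and dominated convergence, which speak of integrals, apply directly. *)
Lemma Lnorm_le_EFin f q e : 0 < q -> 0 <= e ->
  ('N[P]_q%:E[EFin \o f] <= e%:E)%E =
  (\int[P]_w (`|f w| `^ q)%:E <= (e `^ q)%:E)%E.
Proof.
move=> q0 e0; have qn0 : q != 0 by rewrite gt_eqF.
have -> : (\int[P]_w (`|f w| `^ q)%:E)%E = ('N[P]_q%:E[EFin \o f] `^ q)%E.
  by rewrite poweR_Lnorm.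
rewrite -poweR_EFin; apply/idP/idP.
  by apply: gt0_ler_poweR; rewrite ?ltW// in_itv/= leey andbT ?Lnorm_ge0// lee_fin.
have qi0 : 0 <= q^-1 by rewrite invr_ge0 ltW.
move=> h; have := gt0_ler_poweR qi0 _ _ h.
rewrite -!poweRrM divff// !poweRe1 ?lee_fin//; last exact: Lnorm_ge0.
by apply; rewrite in_itv/= leey andbT ?poweR_ge0// lee_fin powR_ge0.
Qed.

Lemma Lnorm_lty f q : 0 < q ->
  ('N[P]_q%:E[EFin \o f] < +oo)%E = (\int[P]_w (`|f w| `^ q)%:E < +oo)%E.
Proof.
move=> q0; have qn0 : q != 0 by rewrite gt_eqF.
have -> : (\int[P]_w (`|f w| `^ q)%:E)%E = ('N[P]_q%:E[EFin \o f] `^ q)%E.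
  by rewrite poweR_Lnorm.
apply/idP/idP; first exact: poweR_lty.
exact: lty_poweRy.
Qed.

Lemma limn_einf_le (u : (\bar R)^nat) (c : \bar R) :
  (forall k, (u k <= c)%E) -> (limn_einf u <= c)%E.
Proof.
move=> uc; rewrite limn_einf_lim; apply: lime_le; first exact: is_cvg_einfs.
apply: nearW => k; apply: le_trans (uc k).
by apply: ereal_inf_lbound; exists k => /=.
Qed.

Lemma cvg_norm_powR (u : nat -> R) (l q : R) : 0 < q ->
  u k @[k --> \oo] --> l -> `|u k| `^ q @[k --> \oo] --> `|l| `^ q.
Proof.
move=> q0 ul; have nul : `|u k| @[k --> \oo] --> `|l| by exact: cvg_norm.
have [l0|l0] := eqVneq l 0.
  rewrite l0 normr0 powR0 ?gt_eqF//; apply/cvgrPdist_le => e e0.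
  move: ul; rewrite l0 => /cvgrPdist_le/(_ (e `^ q^-1)); rewrite powR_gt0//.
  move=> /(_ isT); apply: filterS => k; rewrite !sub0r !normrN => h.
  rewrite ger0_norm ?powR_ge0//.
  have -> : e = (e `^ q^-1) `^ q by rewrite -powRrM mulVf ?gt_eqF// powRr1// ltW.
  by rewrite ge0_ler_powR ?nnegrE ?powR_ge0// ltW.
apply: (@continuous_cvg _ R R _ _ _ (fun x : R => x `^ q) _ _ nul).
apply: differentiable_continuous; apply/derivable1_diffP.
by apply: derivable_powR; rewrite in_itv/= andbT normr_gt0.
Qed.

Lemma emeasurable_fun_limn_einf (u_ : nat -> T -> \bar R) :
  (forall k, measurable_fun setT (u_ k)) ->
  measurable_fun setT (fun w => limn_einf (u_^~ w)).
Proof.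
move=> mu; rewrite (_ : (fun w => _) =
    (fun w => (- limn_esup (fun k => - u_ k w))%E)).
  apply: measurableT_comp => //.
  apply: (measurable_fun_limn_esup (f := fun k w => (- u_ k w)%E)) => k.
  exact: measurableT_comp.
apply/funext => w; rewrite -limn_einfN; congr limn_einf.
by apply/funext => k /=; rewrite oppeK.
Qed.

(** Lower semicontinuity of the norm under almost everywhere convergence: Fatou applied to the q-th
    powers. It serves twice, for completeness and for the norm of the density. *)
Lemma Lnorm_fatou (h_ : nat -> T -> R) h q e : 0 < q -> 0 <= e ->
  (forall k, measurable_fun setT (h_ k)) -> measurable_fun setT h ->
  (\forall w \ae P, h_ k w @[k --> \oo] --> h w) ->
  (forall k, ('N[P]_q%:E[EFin \o h_ k] <= e%:E)%E) ->
  ('N[P]_q%:E[EFin \o h] <= e%:E)%E.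
Proof.
move=> q0 e0 mh_ mh hh hle; rewrite Lnorm_le_EFin//.
have mq k : measurable_fun setT (fun w => (`|h_ k w| `^ q)%:E).
  exact/measurable_EFinP/measurable_norm_powR.
rewrite (_ : (\int[P]_w _)%E =
    (\int[P]_w limn_einf (fun k => (`|h_ k w| `^ q)%:E))%E); last first.
  apply: ae_eq_integral => //.
  - exact/measurable_EFinP/measurable_norm_powR.
  - exact: (emeasurable_fun_limn_einf mq).
  apply: filterS hh => w hw _.
  have c : (`|h_ k w| `^ q)%:E @[k --> \oo] --> (`|h w| `^ q)%:E.
    by apply: cvg_EFin; [exact: nearW|exact: cvg_norm_powR].
  by rewrite (cvg_limn_einf_sup c).
apply: le_trans (fatou _ _ mq _) _ => //.
apply: limn_einf_le => k; have := hle k.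
by rewrite Lnorm_le_EFin.
Qed.

Lemma Lnorm_dominated_cvg0 (h_ : nat -> T -> R) g q : 0 < q ->
  (forall k, measurable_fun setT (h_ k)) -> measurable_fun setT g ->
  ('N[P]_q%:E[EFin \o g] < +oo)%E ->
  (forall k, \forall w \ae P, `|h_ k w| <= g w) ->
  (\forall w \ae P, h_ k w @[k --> \oo] --> 0) ->
  forall e, 0 < e -> \forall k \near \oo, ('N[P]_q%:E[EFin \o h_ k] <= e%:E)%E.
Proof.
move=> q0 mh_ mg; rewrite Lnorm_lty// => gq hg h0 e e0.
have mq f : measurable_fun setT f -> measurable_fun setT (fun w => (`|f w| `^ q)%:E).
  by move=> mf; exact/measurable_EFinP/measurable_norm_powR.
have := @dominated_convergence _ _ _ P setT measurableT
  (fun k w => (`|h_ k w| `^ q)%:E) (cst 0%E) (fun w => (`|g w| `^ q)%:E)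
  (fun k => mq _ (mh_ k)) (measurable_cst _).
case.
- apply: filterS h0 => w h0 _; apply: cvg_EFin; first exact: nearW.
  by have := cvg_norm_powR q0 h0; rewrite normr0 powR0// gt_eqF.
- apply/integrableP; split; first exact: mq.
  apply: le_lt_trans gq; apply: ge0_le_integral => //.
  + by apply: measurableT_comp => //; exact: mq.
  + exact: mq.
  + by move=> w _ /=; rewrite ger0_norm// powR_ge0.
- have := ae_foralln hg; apply: filterS => w hw k _ /=.
  rewrite lee_fin ger0_norm ?powR_ge0//.
  rewrite ge0_ler_powR ?nnegrE// ?(ltW q0)//.
  by rewrite (le_trans (hw k))// ler_norm.
move=> _ _; rewrite integral_cst// mul0e => /fine_cvgP[fink].
move=> /cvgrPdist_le/(_ (e `^ q)); rewrite powR_gt0// => /(_ isT).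
apply: filterS2 fink => k fink; rewrite sub0r normrN /= => h.
rewrite Lnorm_le_EFin ?(ltW e0)// -[leLHS](fineK fink) lee_fin.
exact: le_trans (ler_norm _) h.
Qed.

(** Hölder's inequality for |f|^p and the constant 1, with exponent [r = q / p] and its conjugate.
    The factor contributed by 1 is 1 because the total mass is 1. *)
Lemma Lnorm_le_exponent f p q : 1 <= p -> p <= q -> measurable_fun setT f ->
  ('N[P]_p%:E[EFin \o f] <= 'N[P]_q%:E[EFin \o f])%E.
Proof.
move=> p1; rewrite le_eqVlt => /predU1P[->//|pq] mf.
have p0 : 0 < p by exact: lt_le_trans p1.
have q0 : 0 < q by exact: lt_trans pq.
have [->|] := eqVneq ('N[P]_q%:E[EFin \o f])%E +oo%E; first by rewrite leey.
rewrite -ltey => Nq; have Nq0 := Lnorm_ge0 P q%:E (EFin \o f).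
rewrite -(@fineK _ 'N[P]_q%:E[EFin \o f])%E ?ge0_fin_numE//.
set c := fine _; have c0 : 0 <= c by exact: fine_ge0.
rewrite Lnorm_le_EFin//.
pose r := q / p; pose r' := (1 - r^-1)^-1.
have r1 : 1 < r by rewrite /r ltr_pdivlMr// mul1r.
have r'0 : 0 < r' by rewrite invr_gt0 subr_gt0 invf_lt1// (lt_trans ltr01).
have := @hoelder _ _ _ P (fun w => `|f w| `^ p) (cst 1) r r'
  (measurable_norm_powR p mf) (measurable_cst _) (lt_trans ltr01 r1) r'0.
have rr' : r^-1 + r'^-1 = 1 by rewrite /r' invrK subrKC.
move=> /(_ rr').
have -> : ('N[P]_r'%:E[EFin \o cst 1%R] = 1)%E.
  by have := Lnorm_cst1 P r'; rewrite measure_setT1 poweR1r.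
rewrite mule1.
have -> : ('N[P]_1[EFin \o ((fun w => (`|f w| `^ p)%R) \* cst 1)%R] =
    \int[P]_w (`|f w| `^ p)%:E)%E.
  rewrite Lnorm1; apply: eq_integral => w _ /=.
  by rewrite mulr1 ger0_norm// powR_ge0.
move=> /le_trans; apply; rewrite Lnorm_le_EFin ?powR_ge0 ?(lt_trans _ r1)//.
have -> : (c `^ p) `^ r = c `^ q by rewrite -powRrM mulrCA divff ?mulr1 ?gt_eqF.
have : ('N[P]_q%:E[EFin \o f] <= c%:E)%E by rewrite /c fineK// ge0_fin_numE.
rewrite Lnorm_le_EFin//; congr (_ <= _)%E; apply: eq_integral => w _.
rewrite [`|_ `^ _|]ger0_norm ?powR_ge0// -powRrM mulrCA divff ?mulr1// gt_eqF//.
Qed.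

(** The endpoint [q = 1] is proved apart: there the conjugate norm is an essential supremum, which
    bounds |g| almost everywhere and factors out of the integral. *)
Lemma Lnorm_hoelder f g q : 1 <= q ->
  measurable_fun setT f -> measurable_fun setT g ->
  ('N[P]_1[EFin \o (f \* g)%R] <=
   'N[P]_q%:E[EFin \o f] * 'N[P]_(hoelder_conjugate q%:E)[EFin \o g])%E.
Proof.
move=> q1 mf mg.
have [{q1}->|] := eqVneq q 1.
  rewrite hoelder_conjugate1 !Lnorm1 unlock/= measure_setT1 lte01.
  set M := ess_sup _ _.
  have M0 : (0 <= M)%E.
    by have := Lnorm_ge0 P +oo%E (EFin \o g); rewrite unlock/= measure_setT1 lte01.
  rewrite muleC -ge0_integralZl//; last first.
    by apply/measurable_EFinP; exact: measurableT_comp.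
  apply: ae_ge0_le_integral => //.
  - by apply/measurable_EFinP; apply: measurableT_comp => //; exact: measurable_funM.
  - by move=> w _; rewrite mule_ge0.
  - by apply: measurable_funeM; apply/measurable_EFinP; exact: measurableT_comp.
  have := ess_sup_ge P (abse \o (EFin \o g)).
  apply: filterS => w /= h _.
  by rewrite normrM EFinM muleC lee_wpmul2r.
rewrite neq_lt ltNge q1/= => q1'.
have q0 : 0 < q by exact: lt_trans q1'.
have qm : 0 < q - 1 by rewrite subr_gt0.
have -> : hoelder_conjugate q%:E = (q / (q - 1))%:E.
  by rewrite /hoelder_conjugate/= eqe gt_eqF// inver gt_eqF// -EFinM.
apply: hoelder => //; first by rewrite divr_gt0.
by rewrite invf_div -{1}(mul1r q^-1) -mulrDl subrKC divff// gt_eqF.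
Qed.

End scalar_norms.

(** * Random vectors and their classes *)

Lemma cvg_sumr (R : realType) (I : Type) (r : seq I) (u : I -> nat -> R)
    (l : I -> R) : (forall i, u i k @[k --> \oo] --> l i) ->
  \sum_(i <- r) u i k @[k --> \oo] --> \sum_(i <- r) l i.
Proof.
move=> ul; elim: r => [|i r ih].
  rewrite big_nil (_ : (fun k => _) = cst 0); first exact: cvg_cst.
  by apply/funext => k; rewrite big_nil.
rewrite big_cons (_ : (fun k => _) = (fun k => u i k + \sum_(j <- r) u j k)).
  by apply: cvgD => //; exact: ul.
by apply/funext => k; rewrite big_cons.
Qed.

Section euclidean_norm.
Context (R : realType) (n : nat).
Implicit Types x y : 'rV[R]_n.

Lemma normr_coord_le_enorm x i : `|x 0 i| <= enorm x.
Proof.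
rewrite -sqrtr_sqr; apply: ler_wsqrtr.
rewrite /dotp (bigD1 i)//= -expr2 lerDl.
by apply: sumr_ge0 => j _; rewrite -expr2 sqr_ge0.
Qed.

Lemma enorm_eq0 x : (enorm x == 0) = (x == 0).
Proof.
apply/eqP/eqP => [x0|->]; last exact: enorm0.
apply/rowP => i; rewrite mxE; apply/eqP; rewrite -normr_le0.
by rewrite -x0 normr_coord_le_enorm.
Qed.

Lemma enormN x : enorm (- x) = enorm x.
Proof. by rewrite -scaleN1r enormZ normrN1 mul1r. Qed.

Lemma enorm_delta (i : 'I_n) : enorm (delta_mx 0 i : 'rV[R]_n) = 1.
Proof.
rewrite /enorm /dotp (bigD1 i)//= big1 ?addr0 ?mxE ?eqxx ?mulr1 ?sqrtr1//.
by move=> j ji; rewrite !mxE (negbTE ji) andbF mulr0.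
Qed.

Lemma dotp_delta (i : 'I_n) x : dotp (delta_mx 0 i) x = x 0 i.
Proof.
rewrite /dotp (bigD1 i)//= big1 ?addr0 ?mxE ?eqxx ?mul1r//.
by move=> j ji; rewrite !mxE (negbTE ji) andbF mul0r.
Qed.

Lemma enorm_le_sum x : enorm x <= \sum_(i < n) `|x 0 i|.
Proof.
rewrite [in leLHS](row_sum_delta x).
apply: (big_ind2 (fun (v : 'rV[R]_n) r => enorm v <= r)).
- by rewrite enorm0.
- by move=> v r v' r' vr vr'; rewrite (le_trans (enormD _ _))// lerD.
- by move=> i _; rewrite enormZ enorm_delta mulr1.
Qed.

Lemma normr_dotp_le x y : `|dotp x y| <= enorm x * enorm y.
Proof.
rewrite ler_norml dotp_le andbT lerNl.
have -> : - dotp x y = dotp (- x) y by rewrite -(scaleN1r x) dotpZl mulN1r.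
by rewrite -(enormN x) dotp_le.
Qed.

Lemma cvg_enorm0 (u : nat -> 'rV[R]_n) x :
  (forall i, u k 0 i @[k --> \oo] --> x 0 i) ->
  enorm (u k - x) @[k --> \oo] --> 0.
Proof.
move=> ux; apply: (@squeeze_cvgr _ _ _ _ (cst 0)
    (fun k => \sum_(i < n) `|(u k - x) 0 i|)); last 2 first.
- exact: cvg_cst.
- have h i : `|(u k - x) 0 i| @[k --> \oo] --> `|x 0 i - x 0 i|.
    rewrite (_ : (fun k => _) = (fun k => `|u k 0 i - x 0 i|)).
      by apply: cvg_norm; apply: cvgB; [exact: ux|exact: cvg_cst].
    by apply/funext => k; rewrite !mxE.
  have := @cvg_sumr R _ (index_enum 'I_n) _ _ h.
  by rewrite [X in _ --> X -> _]big1// => i _; rewrite subrr normr0.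
- by apply: nearW => k; rewrite enorm_ge0 enorm_le_sum.
Qed.

Lemma ler_dist_enorm x y : `|enorm x - enorm y| <= enorm (x - y).
Proof.
rewrite ler_norml; apply/andP; split.
  rewrite -(enormN (x - y)) opprB; have := enormD (y - x) x; rewrite subrK; lra.
have := enormD (x - y) y; rewrite subrK; lra.
Qed.

Lemma cvg_enorm (u : nat -> 'rV[R]_n) x :
  (forall i, u k 0 i @[k --> \oo] --> x 0 i) ->
  enorm (u k) @[k --> \oo] --> enorm x.
Proof.
move=> /cvg_enorm0 ux; apply/cvgrPdist_le => e e0.
move/cvgrPdist_le : ux => /(_ e e0); apply: filterS => k.
rewrite sub0r normrN distrC ger0_norm ?enorm_ge0//.
exact/le_trans/ler_dist_enorm.
Qed.

End euclidean_norm.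

Section random_vectors_as_classes.
Context d (T : measurableType d) (R : realType) (P : probability T R) (n : nat).
Implicit Types (x y : L0 P n) (u v : T -> 'rV[R]_n).

Lemma L0_ae_eq x y : (x : T -> 'rV[R]_n) = y %[ae P] -> x = y.
Proof. by move=> xy; rewrite -(reprK x) -(reprK y); apply/L0P/asboolP. Qed.

(** [insubd] makes this total, with the zero class as value on non-measurable [u]. Terms thus carry
    no measurability proof; [toL0E] asks for it where it matters. *)
Definition toL0 u : L0 P n := \pi_(L0 P n)%qT (insubd 0 u : RV T R n).

Lemma toL0E u : u \in @random_vector _ T R n -> (toL0 u : T -> _) = u %[ae P].
Proof. by move=> uP; have := L0_pi P (insubd 0 u : RV T R n); rewrite insubdK. Qed.

Lemma toL0_lin a u v : u \in @random_vector _ T R n -> v \in @random_vector _ T R n ->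
  toL0 (fun w => a *: u w + v w) = a *: toL0 u + toL0 v.
Proof.
move=> mu mv; apply: L0_ae_eq.
have muv : (fun w => a *: u w + v w) \in @random_vector _ T R n.
  exact: (@random_vector_submod _ T R n).2.
have h1 := toL0E muv; have h2 := toL0E mu; have h3 := toL0E mv.
have h4 := L0D (a *: toL0 u) (toL0 v); have h5 := L0Z a (toL0 u).
near=> w => _.
rewrite (near h1 w)// (near h4 w)// (near h5 w)// (near h2 w)// (near h3 w)//.
Unshelve. all: by end_near. Qed.

Lemma random_vector_measurable_enorm u : u \in @random_vector _ T R n ->
  measurable_fun setT (fun w => enorm (u w)).
Proof.
move=> /random_vectorP mu.
rewrite (_ : (fun w => _) = (fun w => (dotp (u w) (u w)) `^ 2^-1)).
  apply: (measurableT_comp (measurable_powR _)).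
  by apply: measurable_sum => i; exact: measurable_funM.
by apply/funext => w; rewrite powR12_sqrt// dotp_ge0.
Qed.

Lemma random_vectorZ (g : T -> R) u : measurable_fun setT g ->
  u \in @random_vector _ T R n -> (fun w => g w *: u w) \in @random_vector _ T R n.
Proof.
move=> mg /random_vectorP mu; apply/random_vectorP => i.
rewrite (_ : (fun w => _) = (fun w => g w * u w 0 i)).
  exact: measurable_funM.
by apply/funext => w; rewrite mxE.
Qed.

Lemma random_vector_L0 x : (x : T -> _) \in @random_vector _ T R n.
Proof. by apply/random_vectorP => i; exact: L0_funP. Qed.

Lemma random_vector_cst (c : 'rV[R]_n) : (fun=> c) \in @random_vector _ T R n.
Proof. by apply/random_vectorP => i; exact: measurable_cst. Qed.

Lemma Lpnorm_le_ae q x (g : T -> R) : 0 < q -> measurable_fun setT g ->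
  (\forall w \ae P, enorm (x w) <= g w) ->
  (Lpnorm q%:E x <= 'N[P]_q%:E[EFin \o g])%E.
Proof.
move=> q0 mg xg; apply: le_Lnorm => //; first exact: measurable_enorm.
by apply: filterS xg => w ->; rewrite enorm_ge0.
Qed.

Lemma Lpnorm_ae q x (g : T -> R) : 0 < q -> measurable_fun setT g ->
  (\forall w \ae P, enorm (x w) = g w) ->
  Lpnorm q%:E x = ('N[P]_q%:E[EFin \o g])%E.
Proof.
move=> q0 mg xg; apply/eqP; rewrite eq_le; apply/andP; split.
  by apply: Lpnorm_le_ae => //; apply: filterS xg => w ->.
apply: le_Lnorm => //; first exact: measurable_enorm.
by apply: filterS xg => w <-; rewrite enorm_ge0 lexx.
Qed.

Lemma Lpnorm_toL0 q u : 0 < q -> u \in @random_vector _ T R n ->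
  Lpnorm q%:E (toL0 u) = ('N[P]_q%:E[EFin \o (fun w => enorm (u w))])%E.
Proof.
move=> q0 mu; apply: Lpnorm_ae => //; first exact: random_vector_measurable_enorm.
by have := toL0E mu; apply: filterS => w /(_ I) ->.
Qed.

Lemma Lnorm_cst_real q (c : R) : 0 < q -> 0 <= c ->
  ('N[P]_q%:E[EFin \o cst c])%E = c%:E.
Proof.
move=> q0 c0; rewrite unlock /=.
rewrite integral_cst// [X in (_ * X)%E](@probability_setT _ _ _ P) mule1.
by rewrite ger0_norm// poweR_EFin -powRrM divff ?gt_eqF// powRr1.
Qed.

Lemma Lp_pinftyP x : Lp +oo%E x <-> exists M, \forall w \ae P, enorm (x w) <= M.
Proof.
rewrite /Lp/= /Lpnorm unlock /=.
have PT : (P : {measure set T -> \bar R}) setT = 1%E by exact: probability_setT.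
rewrite PT lte01; split.
  move=> /ess_supr_bounded[M hM]; exists M; apply: filterS hM => w.
  exact/le_trans/ler_norm.
move=> [M hM]; apply: (@le_lt_trans _ _ M%:E); last exact: ltry.
apply/ess_supP; apply: filterS hM => w hw.
by rewrite /= lee_fin ger0_norm ?enorm_ge0.
Qed.

Lemma Lp_submod_extended (p : \bar R) a x y : (1 <= p)%E ->
  Lp p x -> Lp p y -> Lp p (a *: x + y).
Proof.
case: p => [q|_|//]; first by rewrite lee_fin => /(Lp_submod P n)[_]; exact.
move=> /Lp_pinftyP[M hM] /Lp_pinftyP[M' hM']; apply/Lp_pinftyP.
exists (`|a| * M + M').
have h4 := L0D (a *: x) y; have h5 := L0Z a x.
near=> w; rewrite (near h4 w)// (near h5 w)//.
apply: le_trans (enormD _ _) _; rewrite enormZ lerD//.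
  by rewrite ler_wpM2l//; near: w.
by near: w.
Unshelve. all: by end_near. Qed.

Lemma Lp_Lfun (p : \bar R) x : Lp p x <-> (fun w => enorm (x w)) \in Lfun P p.
Proof.
split=> [xp|]; last by rewrite inE => /andP[_]; rewrite inE.
by rewrite inE; apply/andP; split; rewrite inE//=; exact: measurable_enorm.
Qed.

Lemma Lp_anti (p q : \bar R) x : (1 <= p)%E -> (p <= q)%E -> Lp q x -> Lp p x.
Proof.
move=> p1 pq /Lp_Lfun xq; apply/Lp_Lfun.
apply: (Lfun_subset p1 (le_trans p1 pq) _ pq) xq.
exact: fin_num_measure.
Qed.

(** q / (q - 1) = 1 + 1 / (q - 1) decreases for q > 1; the conjugate of 1 is [+oo], whence the
    separate case. *)
Lemma hoelder_conjugate_anti (p q : R) : 1 <= p -> p <= q ->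
  (hoelder_conjugate q%:E <= hoelder_conjugate p%:E)%E.
Proof.
move=> p1; rewrite le_eqVlt => /predU1P[->//|pq].
have [{p1 pq}->|pn1] := eqVneq p 1; first by rewrite hoelder_conjugate1 leey.
have {p1}p1 : 1 < p by rewrite lt_neqAle eq_sym pn1.
have E r : 1 < r -> hoelder_conjugate r%:E = (r / (r - 1))%:E.
  move=> r1; rewrite /hoelder_conjugate/= eqe gt_eqF ?(lt_trans _ r1)//.
  by rewrite inver gt_eqF ?subr_gt0// -EFinM.
have q1 := lt_trans p1 pq.
rewrite !E// lee_fin ler_pdivrMr ?subr_gt0//.
rewrite mulrAC ler_pdivlMr ?subr_gt0//; nra.
Qed.

Lemma Lpnorm_dotp_hoelder q x y : 1 <= q ->
  (\int[P]_w `|dotp (x w) (y w)|%:E <=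
   Lpnorm q%:E x * Lpnorm (hoelder_conjugate q%:E) y)%E.
Proof.
move=> q1; have := Lnorm_hoelder P q1 (measurable_enorm x) (measurable_enorm y).
apply: le_trans; rewrite Lnorm1; apply: ge0_le_integral => //.
- by apply/measurable_EFinP; apply: measurableT_comp => //; exact: measurable_dotp.
- apply/measurable_EFinP; apply: measurableT_comp => //.
  by apply: measurable_funM; exact: measurable_enorm.
- move=> w _; rewrite lee_fin [leRHS]ger0_norm ?mulr_ge0 ?enorm_ge0//.
  exact: normr_dotp_le.
Qed.

Lemma dotp_integrable q x y : 1 <= q -> Lp q%:E x ->
  Lp (hoelder_conjugate q%:E) y ->
  P.-integrable setT (EFin \o (fun w => dotp (x w) (y w))).
Proof.
move=> q1 xq yq; apply/integrableP; split.
  exact/measurable_EFinP/measurable_dotp.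
apply: le_lt_trans (Lpnorm_dotp_hoelder x y q1) _.
by rewrite lte_mul_pinfty// ?Lnorm_ge0 ?ge0_fin_numE ?Lnorm_ge0.
Qed.

End random_vectors_as_classes.

(** * Metrizability and completeness *)

Lemma near_forall_leq (Q : nat -> nat -> Prop) K :
  (forall k, \forall i \near \oo, Q k i) ->
  \forall i \near \oo, forall k, (k <= K)%N -> Q k i.
Proof.
move=> h; elim: K => [|K IH].
  by have := h 0%N; apply: filterS => i hi k; rewrite leqn0 => /eqP ->.
have := h K.+1; apply: filterS2 IH => i IH hi k.
by rewrite leq_eqVlt => /predU1P[->//|]; exact: IH.
Qed.

Section frechet_of_seminorms.
Context (R : realType) (E : tvsType R) (N : nat -> E -> R).
Hypothesis N_ge0 : forall k x, 0 <= N k x.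
Hypothesis N0 : forall k, N k 0 = 0.
Hypothesis NN : forall k x, N k (- x) = N k x.
Hypothesis ND : forall k x y, N k (x + y) <= N k x + N k y.
Hypothesis N_eq0 : forall x, (forall k, N k x = 0) -> x = 0.
Hypothesis nbhsN : forall x A, nbhs x A <-> exists K, exists2 e, 0 < e &
  [set y | forall k, (k <= K)%N -> N k (y - x) < e] `<=` A.
Hypothesis complete : forall u : nat -> E,
  (forall k e, 0 < e -> exists n0, forall i j, (n0 <= i)%N -> (n0 <= j)%N ->
    N k (u i - u j) < e) ->
  exists l, forall k e, 0 < e -> \forall i \near \oo, N k (u i - l) < e.

(** A supremum of capped seminorms instead of the usual weighted series. Comparison with seminorm
    balls then needs no summation: a distance below [e <= 2^-1 ^+ k] bounds [N k] by [e], and all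
    terms beyond [K] stay below the cap [2^-1 ^+ K]. *)
Let term k x := Num.min (2^-1 ^+ k) (N k x).
Let dist (x y : E) := sup (range (fun k => term k (x - y))).

Let half_gt0 k : 0 < 2^-1 ^+ k :> R.
Proof. by rewrite exprn_gt0// invr_gt0. Qed.

Let half_anti k K : (k <= K)%N -> 2^-1 ^+ K <= 2^-1 ^+ k :> R.
Proof. by move=> kK; rewrite ler_wiXn2l ?invr_ge0// invf_le1// ler1n. Qed.

Let half_small (e : R) : 0 < e -> exists K, 2^-1 ^+ K < e.
Proof.
move=> e0; have : 2^-1 ^+ k @[k --> \oo] --> (0 : R).
  by apply: cvg_expr; rewrite ger0_norm ?invr_ge0// invf_lt1// ltr1n.
move=> /cvgrPdist_lt/(_ e e0)[K _ /(_ K (leqnn K))] h; exists K.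
by move: h; rewrite /= sub0r normrN gtr0_norm.
Qed.

Let term_le_dist k x y : term k (x - y) <= dist x y.
Proof.
apply: ub_le_sup; last by exists k.
exists 1 => _ [j _ <-]; rewrite ge_min.
by rewrite (le_trans (half_anti (leq0n j))).
Qed.

Let dist_le x y e : (forall k, term k (x - y) <= e) -> dist x y <= e.
Proof. by move=> h; apply: ge_sup; [exists (term 0 (x - y)), 0%N|move=> _ [k _ <-]]. Qed.

Let N_lt_dist x y k e : e <= 2^-1 ^+ k -> dist x y < e -> N k (x - y) < e.
Proof.
move=> ek /(le_lt_trans (term_le_dist k x y)).
by rewrite gt_min ltNge ek.
Qed.

Lemma frechet_of_seminorms : frechet_space E.
Proof.
exists dist; split.
- split.
  + move=> x y; split => [xy0|->].
      apply/eqP; rewrite -subr_eq0; apply/eqP/N_eq0 => k.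
      apply/eqP; rewrite eq_le N_ge0 andbT.
      have := term_le_dist k x y; rewrite xy0 /term ge_min leNgt half_gt0.
      by [].
    apply/eqP; rewrite eq_le dist_le/=; last first.
      by move=> k; rewrite subrr /term N0 ge_min lexx orbT.
    apply: le_trans (term_le_dist 0 y y).
    by rewrite /term le_min N_ge0 ltW.
  + move=> x y; rewrite /dist (_ : (fun k => _) = (fun k => term k (y - x)))//.
    by apply/funext => k; rewrite /term -NN opprB.
  + move=> x y z; apply: dist_le => k.
    apply: le_trans (lerD (term_le_dist k x y) (term_le_dist k y z)).
    have := ND k (x - y) (y - z); rewrite subrKA /term.
    have := N_ge0 k (x - y); have := N_ge0 k (y - z); have := half_gt0 k.
    by rewrite !minEle; case: ifP; case: ifP; case: ifP; lra.
- by move=> x y z; rewrite /dist opprD addrACA subrr addr0.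
- move=> x; apply/seteqP; split => A.
    move=> /nbhsN[K [e e0 KA]].
    (* A radius of at most [2^-1 ^+ K] keeps the caps of the seminorms up to [K] inactive. *)
    exists (Num.min e (2^-1 ^+ K)); first by rewrite /= lt_min e0 half_gt0.
    move=> y /= xy; apply: KA => k kK; rewrite -NN opprB.
    apply: lt_le_trans (_ : Num.min e (2^-1 ^+ K) <= e); last first.
      by rewrite ge_min lexx.
    apply: N_lt_dist xy; rewrite ge_min (half_anti kK) orbT//.
  move=> [e /= e0 eA]; apply/nbhsN.
  have e2 : 0 < e / 2 by rewrite divr_gt0.
  (* Seminorms up to [K] are controlled by the ball and later ones by their caps. Half of [e] is
     used because a bound on all terms gives only a weak inequality for the supremum. *)
  have [K hK] := half_small e2; exists K, (e / 2) => // y yx.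
  apply: eA => /=; apply: (@le_lt_trans _ _ (e / 2)); last by lra.
  apply: dist_le => k; rewrite /term ge_min.
  have [kK|Kk] := leqP k K.
    by rewrite -[X in _ || (X <= _)]NN opprB [X in _ || X]ltW ?orbT ?yx.
  by rewrite (le_trans (half_anti (ltnW Kk)))// ltW.
- move=> u uC; have [|l hl] := complete (u := u).
    move=> k e e0; pose e' := Num.min e (2^-1 ^+ k).
    have [|n0 h] := uC e'; first by rewrite lt_min e0 half_gt0.
    exists n0 => i j i0 j0; apply: lt_le_trans (_ : e' <= e); last first.
      by rewrite ge_min lexx.
    by apply: N_lt_dist; [rewrite ge_min lexx orbT|exact: h].
  exists l => A /nbhsN[K [e e0 KA]].
  have := near_forall_leq K (fun k => hl k e e0).
  by apply: filterS => i; exact: KA.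
Qed.

End frechet_of_seminorms.

(** * Almost everywhere limits of sequences with summable increments *)

Section lp_limits.
Context d (T : measurableType d) (R : realType) (P : probability T R) (n : nat).
Implicit Types (x y : L0 P n).

Lemma L0B x y : L0_fun (x - y) = (fun w => x w - y w) %[ae P].
Proof.
have := L0Z (-1) y; rewrite scaleN1r; have := L0D x (- y).
by apply: filterS2 => w /(_ I) -> /(_ I) ->; rewrite scaleN1r.
Qed.

Lemma Lpnorm_fatou (x_ : nat -> L0 P n) x q e : 0 < q -> 0 <= e ->
  (\forall w \ae P, forall i, x_ j w 0 i @[j --> \oo] --> x w 0 i) ->
  (forall j, (Lpnorm q%:E (x_ j) <= e%:E)%E) -> (Lpnorm q%:E x <= e%:E)%E.
Proof.
move=> q0 e0 hx; apply: Lnorm_fatou => //.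
- by move=> k; exact: measurable_enorm.
- exact: measurable_enorm.
- by apply: filterS hx => w; exact: cvg_enorm.
Qed.

Lemma cvgn_series_lty (a : nat -> R) : (forall j, 0 <= a j) ->
  (\sum_(0 <= j <oo) (a j)%:E < +oo)%E -> cvgn (series a).
Proof.
move=> a0 sa; have s0 : (0 <= \sum_(0 <= j <oo) (a j)%:E)%E.
  by apply: nneseries_ge0 => j _ _; rewrite lee_fin.
apply: nondecreasing_is_cvgn; first exact/nondecreasing_series.
exists (fine (\sum_(0 <= j <oo) (a j)%:E)%E) => _ [k _ <-].
rewrite -lee_fin fineK ?ge0_fin_numE// /series/= -sumEFin.
by apply: nneseries_lim_ge => j _; rewrite lee_fin.
Qed.

Lemma Lpnorm_summable_ae_cvg q (u : nat -> L0 P n) : 1 <= q ->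
  (forall j, (Lpnorm q%:E (u j.+1 - u j)%R <= (2^-1 ^+ j)%:E)%E) ->
  exists l : L0 P n,
    \forall w \ae P, forall i, u j w 0 i @[j --> \oo] --> l w 0 i.
Proof.
move=> q1 hu.
pose S w := (\sum_(0 <= j <oo) (enorm (L0_fun (u j.+1 - u j)%R w))%:E)%E.
have mS j : measurable_fun setT (fun w => (enorm (L0_fun (u j.+1 - u j)%R w))%:E).
  exact/measurable_EFinP/measurable_enorm.
have iS : P.-integrable setT S.
  apply/integrableP; split.
    apply: (ge0_emeasurable_sum (P := xpredT)) => // j w _ _.
    by rewrite lee_fin enorm_ge0.
  under eq_integral => w _.
    rewrite gee0_abs; last by apply: nneseries_ge0 => j _ _; rewrite lee_fin enorm_ge0.
    over.
  rewrite integral_nneseries//; last by move=> j w _; rewrite lee_fin enorm_ge0.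
  apply: (@le_lt_trans _ _ (\sum_(0 <= j <oo) (2^-1 ^+ j)%:E)%E).
    apply: lee_nneseries => j *.
      by apply: integral_ge0 => w _; rewrite lee_fin enorm_ge0.
    apply: le_trans (hu j).
    have := Lnorm_le_exponent P (lexx 1) q1 (measurable_enorm (u j.+1 - u j)).
    apply: le_trans; rewrite Lnorm1; apply: ge0_le_integral => //.
    - by move=> w _; rewrite lee_fin enorm_ge0.
    - apply/measurable_EFinP; apply: measurableT_comp => //.
      exact: measurable_enorm.
    - by move=> w _ /=; rewrite lee_fin ler_norm.
  apply: (@le_lt_trans _ _ (1 / (1 - 2^-1))%:E); last exact: ltry.
  apply: lime_le; first by apply: is_cvg_nneseries => j _ _; rewrite lee_fin exprn_ge0.
  apply: nearW => k; rewrite sumEFin lee_fin.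
  have := @geometric_le_lim R k 1 2^-1 ler01.
  rewrite invr_gt0 ltr0n ger0_norm ?invr_ge0// invf_lt1// ltr1n.
  move=> /(_ isT isT); rewrite /series/=.
  by under eq_bigr do rewrite mul1r.
(* [fine] of the upper limit is defined and measurable everywhere, before any convergence is known;
   it is the true limit wherever the sequence converges. *)
pose l w : 'rV[R]_n := \row_i fine (limn_esup (fun j => (u j w 0 i)%:E)).
have ml : l \in @random_vector _ T R n.
  apply/random_vectorP => i.
  rewrite (_ : (fun w => _) =
      (fun w => fine (limn_esup (fun j => (u j w 0 i)%:E)))).
    apply: measurableT_comp => //.
    apply: (measurable_fun_limn_esup (f := fun j w => (u j w 0 i)%:E)) => j.
    by apply/measurable_EFinP; exact: L0_funP.
  by apply/funext => w; rewrite mxE.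
exists (toL0 P l).
have hd := ae_foralln (fun j => L0B (u j.+1) (u j)).
have hf := integrable_ae measurableT iS.
have hl := toL0E P ml.
near=> w => i; rewrite (near hl w)// mxE.
have : cvgn (series (fun j => u j.+1 w 0 i - u j w 0 i)).
  apply: normed_cvg; rewrite /normed_series_of.
  apply: (@series_le_cvg _ _ (fun j => enorm (L0_fun (u j.+1 - u j)%R w))).
  - by move=> j; exact: normr_ge0.
  - by move=> j; exact: enorm_ge0.
  - move=> j; rewrite (near hd w)//=.
    by apply: le_trans (normr_coord_le_enorm _ i); rewrite !mxE.
  apply: cvgn_series_lty; first by move=> j; exact: enorm_ge0.
  by have := near hf w; rewrite ltey_eq => -> //.
move=> /cvg_ex[c hc].
have {}hc : u j w 0 i @[j --> \oo] --> c + u 0%N w 0 i.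
  rewrite (_ : (fun j => _) =
      (fun j => series (fun j => u j.+1 w 0 i - u j w 0 i) j + u 0%N w 0 i)).
    by apply: cvgD => //; exact: cvg_cst.
  by apply/funext => j; rewrite /series/= telescope_sumr// subrK.
have {}hE : (u j w 0 i)%:E @[j --> \oo] --> (c + u 0%N w 0 i)%:E.
  by apply: cvg_EFin => //; exact: nearW.
by rewrite (cvg_limn_einf_sup hE).
Unshelve. all: by end_near. Qed.

End lp_limits.

(** * Norms, neighborhoods and completeness of the intersection space *)

Section intersection_space.
Context d (T : measurableType d) (R : realType) (P : probability T R) (n : nat).
Context (S : set R) (S1 : S `<=` `[1, +oo[).
Local Notation U := (Uspace P n S1).
Implicit Types (u v : U) (q : R).

Lemma exponent_ge1 q : S q -> 1 <= q.
Proof. by move=> /S1/=; rewrite in_itv/= andbT. Qed.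

Lemma Uspace_Lp u q : S q -> Lp q%:E (Uval u).
Proof. by move=> Sq; have /capLP := UvalP u; apply. Qed.

Lemma Unorm_ge0 q u : 0 <= Unorm q u.
Proof. exact/fine_ge0/Lnorm_ge0. Qed.

Lemma UnormD q u v : S q -> Unorm q (u + v) <= Unorm q u + Unorm q v.
Proof.
move=> Sq; rewrite -lee_fin EFinD !Unorm_EFin//.
exact/LpnormD/exponent_ge1.
Qed.

Lemma UnormZ q a u : S q -> Unorm q (a *: u) = `|a| * Unorm q u.
Proof.
move=> Sq; apply: EFin_inj; rewrite EFinM !Unorm_EFin//.
by apply: LpnormZ; [exact: exponent_ge1|exact: Uspace_Lp].
Qed.

Lemma Unorm0 q : S q -> Unorm q (0 : U) = 0.
Proof. by move=> Sq; rewrite -(scale0r (0 : U)) UnormZ// normr0 mul0r. Qed.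

Lemma UnormN q u : S q -> Unorm q (- u) = Unorm q u.
Proof. by move=> Sq; rewrite -scaleN1r UnormZ// normrN1 mul1r. Qed.

Lemma Unorm_le_exponent p q u : S p -> S q -> p <= q -> Unorm p u <= Unorm q u.
Proof.
move=> Sp Sq pq; rewrite -lee_fin !Unorm_EFin//.
by apply: Lnorm_le_exponent => //; [exact: exponent_ge1|exact: measurable_enorm].
Qed.

Lemma Unorm_eq0 q u : S q -> Unorm q u = 0 -> u = 0.
Proof.
move=> Sq u0; have : Lpnorm q%:E (Uval u) = 0%E by rewrite -Unorm_EFin// u0.
move=> /Lnorm_eq0_eq0 h; apply: val_inj; apply: L0_ae_eq.
have q0 : (0 < q%:E)%E by rewrite lte_fin (lt_le_trans ltr01 (exponent_ge1 Sq)).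
have mu : measurable_fun setT (EFin \o (fun w => enorm (Uval u w))).
  exact/measurable_EFinP/measurable_enorm.
have {}h := h mu q0.
have := L0_0 P n; apply: filterS2 h => w /(_ I)/= [/eqP].
by rewrite enorm_eq0 => /eqP -> /(_ I) ->.
Qed.

Lemma nbhs_UspaceE u A : nbhs u A <-> seminorm_nbhs S (@Unorm _ _ _ P n S S1) u A.
Proof. by []. Qed.

Definition toU (x : L0 P n) : U := insubd 0 x.

Lemma toUK x : x \in capL S1 -> Uval (toU x) = x.
Proof. exact: insubdK. Qed.

Lemma UvalK u : toU (Uval u) = u.
Proof. by apply: val_inj; rewrite insubdK//; exact: UvalP. Qed.

Lemma toU_lin a x y : x \in capL S1 -> y \in capL S1 ->
  toU (a *: x + y) = a *: toU x + toU y.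
Proof.
move=> xS yS; have [_ capL_lin] := @capL_submod _ _ _ P n _ S1.
by apply: val_inj; rewrite /= !insubdK//; exact: capL_lin.
Qed.

(** The subsequence is extracted for the single norm [s 0]. Its almost everywhere limit does not
    refer to any norm, so Fatou's lemma can be applied with each [s k] in turn, with no diagonal
    extraction. *)
Lemma Uspace_complete (s : nat -> R) (u : nat -> U) : S = range s ->
  (forall k e, 0 < e -> exists n0, forall i j, (n0 <= i)%N -> (n0 <= j)%N ->
    Unorm (s k) (u i - u j) < e) ->
  exists l, forall k e, 0 < e -> \forall i \near \oo, Unorm (s k) (u i - l) < e.
Proof.
move=> Ss uC.
have Sk k : S (s k) by rewrite Ss; exists k.
have h2 j : 0 < 2^-1 ^+ j :> R by rewrite exprn_gt0// invr_gt0.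
have [N0 hN0] := choice (fun j => uC 0%N (2^-1 ^+ j) (h2 j)).
(* The sum makes [f] nondecreasing and at least [N0 j], so both indices of the j-th increment lie
   beyond [N0 j]; the added [j] makes [f] tend to infinity. *)
pose f j := (\sum_(i < j.+1) N0 i + j)%N.
have f_ge j : (N0 j <= f j)%N.
  by rewrite /f big_ord_recr/= -addnA addnCA leq_addr.
have f_ge_id j : (j <= f j)%N by rewrite leq_addl.
have fS j : (f j <= f j.+1)%N.
  by rewrite /f [in leqRHS]big_ord_recr/= -addnA leq_add2l addnS ltnW// ltnS leq_addl.
have [|l hl] := @Lpnorm_summable_ae_cvg _ _ _ P n (s 0%N) (fun j => Uval (u (f j)))
    (exponent_ge1 (Sk 0%N)).
  move=> j; have := hN0 j (f j.+1) (f j) (leq_trans (f_ge j) (fS j)) (f_ge j).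
  by move=> /ltW; rewrite -lee_fin Unorm_EFin.
have close k e : 0 < e -> exists n0, forall i, (n0 <= i)%N ->
    (Lpnorm (s k)%:E (Uval (u i) - l)%R <= e%:E)%E.
  move=> e0; have [n0 hn0] := uC k e e0; exists n0 => i n0i.
  have q1 := exponent_ge1 (Sk k).
  (* With [i] fixed, let the second index of the Cauchy estimate run along the subsequence. The
     shift by [n0] puts all its indices beyond [n0]. *)
  apply: (@Lpnorm_fatou _ _ _ _ _ (fun j => Uval (u i) - Uval (u (f (j + n0))))).
  - exact: lt_le_trans q1.
  - exact: ltW.
  - have hd := ae_foralln (fun j => L0B (Uval (u i)) (Uval (u (f (j + n0))))).
    have hd' := L0B (Uval (u i)) l.
    near=> w => c; rewrite (near hd' w)// !mxE.
    rewrite (_ : (fun j => _) =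
        (fun j => Uval (u i) w 0 c - Uval (u (f (j + n0))) w 0 c)).
      apply: cvgB; first exact: cvg_cst.
      by have := near hl w _ c; rewrite -(cvg_shiftn n0); apply.
    by apply/funext => j; rewrite (near hd w)// !mxE.
  - move=> j; have := hn0 i (f (j + n0)%N) n0i.
    move=> /(_ (leq_trans (leq_addl _ _) (f_ge_id _))) /ltW.
    by rewrite -lee_fin Unorm_EFin.
have lS : l \in capL S1.
  apply/capLP => q; rewrite {1}Ss => -[k _ <-].
  have [n0 /(_ n0 (leqnn n0)) h] := close k 1 ltr01.
  (* [l] is [u n0] minus a difference that has just been bounded in this norm. *)
  rewrite -(subKr (Uval (u n0)) l) -scaleN1r addrC.
  apply: (Lp_submod P n (exponent_ge1 (Sk k))).2; last exact: Uspace_Lp.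
  by apply: le_lt_trans h _; exact: ltry.
exists (toU l) => k e e0.
have e2 : 0 < e / 2 by rewrite divr_gt0.
have [n0 h] := close k _ e2; exists n0 => // i /= n0i.
apply: (@le_lt_trans _ _ (e / 2)); last by lra.
rewrite -lee_fin Unorm_EFin// /= insubdK//; exact: h.
Unshelve. all: by end_near. Qed.

Lemma frechet_Uspace (s : nat -> R) : S = range s -> frechet_space (U : tvsType R).
Proof.
move=> Ss; have Sk k : S (s k) by rewrite Ss; exists k.
apply: (@frechet_of_seminorms R (U : tvsType R) (fun k => Unorm (s k))).
- by move=> k u; exact: Unorm_ge0.
- by move=> k; exact: Unorm0.
- by move=> k u; exact: UnormN.
- by move=> k u v; exact: UnormD.
- by move=> u /(_ 0%N); exact: Unorm_eq0.
- move=> u A; apply: (iff_trans (nbhs_UspaceE u A)); split.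
    move=> [F FS [e e0 FA]].
    (* Basic neighborhoods use arbitrary finite sets of exponents, the metric initial segments of
       the enumeration; any finite set lies in such a segment. *)
    have [K hK] : exists K, forall q, q \in F -> exists2 k, (k <= K)%N & q = s k.
      elim: F FS {FA} => [|q F IH] FS; first by exists 0%N.
      have [|K hK] := IH; first by move=> r rF; apply: FS; rewrite inE rF orbT.
      have : S q by apply: FS; rewrite mem_head.
      rewrite Ss => -[k _ kq]; exists (maxn k K) => r.
      rewrite inE => /predU1P[->|/hK[j jK ->]].
        by exists k => //; rewrite leq_maxl.
      by exists j => //; rewrite (leq_trans jK)// leq_maxr.
    by exists K, e => // v h; apply: FA => q /hK[k kK ->]; exact: h.
  move=> [K [e e0 KA]]; exists [seq s k | k <- iota 0 K.+1].
    by move=> q /mapP[k _ ->].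
  exists e => // v h; apply: KA => k kK; apply: h.
  by apply: map_f; rewrite mem_iota.
- by move=> u; exact: Uspace_complete.
Qed.

End intersection_space.

(** * Bounded functionals on scalar functions *)

Section finite_norms.
Context d (T : measurableType d) (R : realType) (P : probability T R).
Context (S : set R) (S1 : S `<=` `[1, +oo[).
Implicit Types (f g h : T -> R) (q : R).

(** The scalar counterpart of the intersection space, stated for functions and not classes so that
    indicators, simple approximations and pointwise limits can be handled without quotients. *)
Definition finite_norms g :=
  measurable_fun setT g /\ forall q, S q -> ('N[P]_q%:E[EFin \o g] < +oo)%E.

Lemma le_Lnorm_norm g h q : 0 < q -> measurable_fun setT g ->
  measurable_fun setT h -> (forall w, `|g w| <= `|h w|) ->
  ('N[P]_q%:E[EFin \o g] <= 'N[P]_q%:E[EFin \o h])%E.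
Proof.
move=> q0 mg mh gh; rewrite -(Lnorm_abse P (_ \o g)) -(Lnorm_abse P (_ \o h)).
apply: (@le_Lnorm _ _ _ P (Num.norm \o g) (Num.norm \o h)) => //.
- exact: measurableT_comp.
- exact: measurableT_comp.
- by apply: nearW => w /=; rewrite normr_ge0 gh.
Qed.

Lemma finite_norms_le g h : measurable_fun setT g -> finite_norms h ->
  (forall w, `|g w| <= `|h w|) -> finite_norms g.
Proof.
move=> mg [mh fh] gh; split => // q Sq; apply: le_lt_trans (fh q Sq).
by apply: le_Lnorm_norm => //; rewrite (lt_le_trans ltr01 (exponent_ge1 S1 Sq)).
Qed.

Lemma finite_norms_cst (c : R) : finite_norms (cst c).
Proof.
split => // q Sq; have q0 := lt_le_trans ltr01 (exponent_ge1 S1 Sq).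
have -> : ('N[P]_q%:E[EFin \o cst c] = 'N[P]_q%:E[EFin \o cst `|c|%R])%E.
  by rewrite -Lnorm_abse.
by rewrite Lnorm_cst_real// ltry.
Qed.

Lemma finite_norms_bounded g (M : R) : measurable_fun setT g ->
  (forall w, `|g w| <= M) -> finite_norms g.
Proof.
move=> mg gM; apply: finite_norms_le (finite_norms_cst M) _ => // w.
by rewrite (le_trans (gM w))// ler_norm.
Qed.

Lemma finite_norms_lin a g h : finite_norms g -> finite_norms h ->
  finite_norms (fun w => a * g w + h w).
Proof.
move=> [mg fg] [mh fh]; split.
  by apply: measurable_funD => //; exact: measurable_funM.
move=> q Sq; have q1 := exponent_ge1 S1 Sq.
apply: (@le_lt_trans _ _ ('N[P]_q%:E[EFin \o (fun w => a * g w)%R] +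
    'N[P]_q%:E[EFin \o h])%E).
  by apply: eminkowski => //; rewrite ?lee_fin//; exact: measurable_funM.
rewrite lte_add_pinfty ?fh//.
have gL : g \in Lfun P q%:E.
  by rewrite inE; apply/andP; split; rewrite inE//; exact: fg.
have := Lfun_scale a q1 gL; rewrite inE => /andP[_]; rewrite inE /finite_norm.
by under eq_Lnorm do rewrite /= mulrC.
Qed.

(** * Integral representation of a bounded scalar functional *)

Section representation.
Import HBNNSimple.
Context (q C : R) (Sq : S q) (C0 : 0 <= C).
Context (L : (T -> R) -> R).
Hypothesis L_lin : forall a g h, finite_norms g -> finite_norms h ->
  L (fun w => a * g w + h w) = a * L g + L h.
Hypothesis L_bound : forall g, finite_norms g ->
  (`|L g|%:E <= C%:E * 'N[P]_q%:E[EFin \o g])%E.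

Let q0 : 0 < q. Proof. exact: lt_le_trans ltr01 (exponent_ge1 S1 Sq). Qed.

Let L_cst0 : L (cst 0) = 0.
Proof.
apply/eqP; rewrite -normr_le0 -lee_fin.
apply: le_trans (L_bound (finite_norms_cst 0)) _.
by rewrite Lnorm_cst_real// mule0.
Qed.

(** Dominated convergence turns pointwise convergence into convergence in the one norm that bounds
    [L]. Both countable additivity and the passage from simple functions to general ones rest on
    this. *)
Let L_cvg (g_ : nat -> T -> R) g h :
  (forall k, finite_norms (g_ k)) -> finite_norms g -> finite_norms h ->
  (forall k w, `|g_ k w - g w| <= h w) ->
  (forall w, g_ k w @[k --> \oo] --> g w) -> L (g_ k) @[k --> \oo] --> L g.
Proof.
move=> fg_ fg fh gh gg; apply/cvgrPdist_le => e e0.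
(* [C] may be 0, so the tolerance is divided by [C + 1]. *)
have C1 : 0 < C + 1 by rewrite ltr_wpDl.
pose D k w := -1 * g w + g_ k w.
have DE k w : D k w = g_ k w - g w by rewrite /D mulN1r addrC.
have fD k : finite_norms (D k) by exact: finite_norms_lin.
have := @Lnorm_dominated_cvg0 _ _ _ P D h q q0 (fun k => (fD k).1) fh.1 (fh.2 _ Sq).
move=> /(_ _ _ (e / (C + 1))); rewrite divr_gt0// => dc.
have {dc} : \forall k \near \oo,
    ('N[P]_q%:E[EFin \o D k] <= (e / (C + 1))%:E)%E.
  apply: dc => //.
    by move=> k; apply: nearW => w; rewrite DE.
  apply: nearW => w; under eq_fun do rewrite DE.
  by rewrite -(subrr (g w)); apply: cvgB; [exact: gg|exact: cvg_cst].
apply: filterS => k hk.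
have -> : L g - L (g_ k) = - L (D k) by rewrite L_lin//; ring.
rewrite normrN -lee_fin; apply: le_trans (L_bound (fD k)) _.
apply: (@le_trans _ _ (C%:E * (e / (C + 1))%:E)%E).
  by rewrite lee_wpmul2l// lee_fin.
by rewrite -EFinM lee_fin mulrCA ger_pMr// ler_pdivrMr// mul1r lerDl ler01.
Qed.

Let fnorms_indic A : measurable A -> finite_norms \1_A.
Proof.
move=> mA; apply: (@finite_norms_bounded _ 1); first exact: measurable_indic.
by move=> w; rewrite indicE; case: (w \in A); rewrite /= ?normr1 ?normr0.
Qed.

Let nu (A : set T) : \bar R := (L \1_A)%:E.

Let nu0 : nu set0 = 0%E.
Proof. by rewrite /nu indic0 L_cst0. Qed.

(** At a given point a disjoint family has no member or exactly one. Partial sums of indicators are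
    therefore constantly 0, or jump once from 0 to 1, which gives their bound and their limit. *)
Let sum_indic_disjoint (F : nat -> set T) w : trivIset setT F ->
  (forall k, \1_(F k) w = 0 :> R) /\ \1_(\bigcup_k F k) w = 0 :> R \/
  exists k0, (forall k, \1_(F k) w = (k == k0)%:R :> R) /\
    \1_(\bigcup_k F k) w = 1 :> R.
Proof.
move=> tF; have [[k0 _ Fw]|nF] := pselect ((\bigcup_k F k) w).
  right; exists k0; split; last by rewrite indicE mem_set//; exists k0.
  move=> k; rewrite indicE; have [->|kk0] := eqVneq k k0; first by rewrite mem_set.
  rewrite memNset// => Fkw.
  by move/eqP : kk0; apply; apply: tF => //; exists w.
left; split; last by rewrite indicE memNset.
by move=> k; rewrite indicE memNset// => Fkw; apply: nF; exists k.
Qed.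

Let sum_eq_nat k0 m : \sum_(0 <= k < m) (k == k0)%:R = (k0 < m)%N%:R :> R.
Proof.
elim: m => [|m IH]; first by rewrite big_nil.
rewrite big_nat_recr//= IH ltnS (leq_eqVlt k0) [m == k0]eq_sym.
have [->|_] := eqVneq k0 m; first by rewrite ltnn add0r.
by rewrite addr0.
Qed.

(** The partial sums [B m] lie between 0 and 1 and converge pointwise to the indicator of the union,
    so [L_cvg] applies with the constant 1 in the domination. *)
Let nu_sigma_additive : semi_sigma_additive nu.
Proof.
move=> F mF tF mUF.
pose B m w : R := \sum_(0 <= k < m) \1_(F k) w.
have B01 m w : 0 <= B m w <= 1.
  have [[F0 _]|[k0 [F1 _]]] := sum_indic_disjoint w tF.
    by rewrite /B big1 ?lexx ?ler01// => k _; rewrite F0.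
  rewrite /B (eq_bigr _ (fun k _ => F1 k)) sum_eq_nat.
  by case: (_ < _)%N; rewrite /= ?lexx ?ler01.
have fB m : finite_norms (B m).
  apply: (@finite_norms_bounded _ 1).
    by apply: measurable_sum => k; exact: measurable_indic.
  by move=> w; have /andP[B0 B1] := B01 m w; rewrite ger0_norm.
have LB m : (\sum_(0 <= k < m) nu (F k))%E = (L (B m))%:E.
  elim: m => [|m IH].
    rewrite big_nil; congr _%:E; rewrite -[LHS]L_cst0; congr L.
    by apply/funext => w; rewrite /B big_nil.
  rewrite big_nat_recr//= IH -EFinD; congr _%:E.
  have := L_lin 1 (fB m) (fnorms_indic (mF m)).
  rewrite mul1r => <-; congr L.
  by apply/funext => w; rewrite /B big_nat_recr//= mul1r.
under eq_fun do rewrite LB.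
apply: cvg_EFin; first exact: nearW.
apply: (@L_cvg _ _ (cst 1)) => //.
- exact: fnorms_indic.
- exact: finite_norms_cst.
- move=> m w; have /andP[B0 B1] := B01 m w.
  rewrite indicE; case: (_ \in _); rewrite /= ler_norml; lra.
- move=> w; have [[F0 ->]|[k0 [F1 ->]]] := sum_indic_disjoint w tF.
    rewrite (_ : (fun _ => _) = cst 0); first exact: cvg_cst.
    by apply/funext => m; rewrite /B big1.
  (* [B m] sums over [k < m], so it counts the index [k0] exactly when [m] exceeds [k0]. *)
  apply: cvg_near_cst; exists k0.+1 => // m /= k0m.
  by rewrite /B (eq_bigr _ (fun k _ => F1 k)) sum_eq_nat k0m.
Qed.

Let nu_fin A : measurable A -> nu A \is a fin_num. Proof. by []. Qed.

Let nu_null A : measurable A -> P A = 0%E -> nu A = 0%E.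
Proof.
move=> mA PA0; apply/eqP; rewrite eqe -normr_le0 -lee_fin.
apply: le_trans (L_bound (fnorms_indic mA)) _.
rewrite [leRHS](_ : _ = (C%:E * 'N[P]_q%:E[EFin \o cst 0%R])%E); last first.
  by rewrite Lnorm_cst_real// mule0.
rewrite lee_wpmul2l ?lee_fin//; apply: le_Lnorm => //.
(* The null set [A] itself is the exceptional set: its indicator vanishes elsewhere. *)
exists A; split => // w /=; apply: contra_notP => nA.
by rewrite indicE memNset//= lexx.
Qed.

Let density : exists y : T -> R,
  [/\ measurable_fun setT y, P.-integrable setT (EFin \o y) &
      forall A, measurable A ->
        (L \1_A)%:E = (\int[P]_w (\1_A w * y w)%:E)%E].
Proof.
pose nuC : {charge set T -> \bar R} :=
  HB.pack nu (isCharge.Build _ _ _ nu nu0 nu_fin nu_sigma_additive).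
have nuP : nuC `<< P.
  by apply/null_content_dominatesP => A mA; exact: nu_null.
pose y w := fine (Radon_Nikodym nuC P w).
have yE : EFin \o y = Radon_Nikodym nuC P.
  by apply/funext => w; rewrite /= fineK//; exact: Radon_Nikodym_fin_num.
have iy : P.-integrable setT (EFin \o y).
  by rewrite yE; exact: Radon_Nikodym_integrable.
exists y; split => //.
  by apply/measurable_EFinP; case/integrableP : iy.
move=> A mA; have := Radon_Nikodym_integral nuP mA.
rewrite -yE [nuC A]/(nu A) => ->; rewrite integral_mkcond.
apply: eq_integral => w _; rewrite patchE indicE.
by case: ifPn => _ /=; rewrite ?mul1r ?mul0r.
Qed.

(** Keeping integrability next to the identity makes the predicate stable under linear combinations,
    as the induction over simple functions requires. *)
Let good (y : T -> R) g := [/\ finite_norms g,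
  P.-integrable setT (EFin \o (fun w => g w * y w)) &
  (L g)%:E = (\int[P]_w (g w * y w)%:E)%E].

Let good_lin y a g h : good y g -> good y h -> good y (fun w => a * g w + h w).
Proof.
move=> [fg ig Lg] [fh ih Lh].
have E : (EFin \o (fun w => (a * g w + h w) * y w)) =
    (fun w => a%:E * (g w * y w)%:E + (h w * y w)%:E)%E.
  by apply/funext => w /=; rewrite -EFinM -EFinD mulrDl mulrA.
have iag : P.-integrable setT (fun w => a%:E * (g w * y w)%:E)%E.
  exact: integrableZl.
split; first exact: finite_norms_lin.
  by rewrite E; exact: integrableD.
transitivity (\int[P]_w (a%:E * (g w * y w)%:E + (h w * y w)%:E))%E; last first.
  by apply: eq_integral => w _; rewrite -EFinM -EFinD mulrDl mulrA.
by rewrite integralD// integralZl// -Lg -Lh L_lin.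
Qed.

Let good_cst0 y : good y (cst 0).
Proof.
have E : (fun w => (cst (0 : R) w * y w)%:E) = cst 0%E.
  by apply/funext => w /=; rewrite mul0r.
split; first exact: finite_norms_cst.
  by rewrite (_ : _ \o _ = cst 0%E)//; exact: integrable0.
by rewrite L_cst0 E integral0.
Qed.

(** Extension from indicators to simple, then nonnegative, then signed functions. Integrability of
    [g * y] is a premise because [y] is so far only integrable, with no bound in the conjugate
    space. *)
Lemma representation : exists y : T -> R,
  [/\ measurable_fun setT y, P.-integrable setT (EFin \o y) &
      forall g, finite_norms g ->
        P.-integrable setT (EFin \o (fun w => g w * y w)) ->
        (L g)%:E = (\int[P]_w (g w * y w)%:E)%E].
Proof.
have [y [my iy Ly]] := density; exists y; split => //.
have good_indic A : measurable A -> good y \1_A.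
  move=> mA; split; [exact: fnorms_indic| |exact: Ly].
  apply: le_integrable iy => //.
    apply/measurable_EFinP; exact: measurable_funM.
  move=> w _ /=; rewrite lee_fin indicE normrM.
  by case: (_ \in _); rewrite /= ?normr1 ?normr0 ?mul1r ?mul0r.
have good_nnsfun (h : {nnsfun T >-> R}) : good y h.
  have -> : (h : T -> R) = (fun w =>
      \sum_(c <- finmap.enum_fset (fset_set (range h)))
      (c * \1_(h @^-1` [set c]) w)).
    by apply/funext => w; rewrite fimfunE fsbig_finite//.
  elim: (finmap.enum_fset _) => [|c s IH].
    rewrite (_ : (fun w => _) = cst 0); first exact: good_cst0.
    by apply/funext => w; rewrite big_nil.
  rewrite (_ : (fun w => _) = (fun w => c * \1_(h @^-1` [set c]) w +
      \sum_(c <- s) (c * \1_(h @^-1` [set c]) w))).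
    by apply: good_lin => //; exact: good_indic.
  by apply/funext => w; rewrite big_cons.
have good_ge0 g : (forall w, 0 <= g w) -> finite_norms g ->
    P.-integrable setT (EFin \o (fun w => g w * y w)) -> good y g.
  move=> g0 fg ig; split => //.
  have mg : measurable_fun setT (EFin \o g) by apply/measurable_EFinP; exact: fg.1.
  pose h k : {nnsfun T >-> R} := nnsfun_approx measurableT mg k.
  have hg w : h k w @[k --> \oo] --> g w.
    have := @cvg_nnsfun_approx _ _ _ _ measurableT _ mg (fun w _ => g0 w) w I.
    by move=> /fine_cvgP[_].
  have hle k w : h k w <= g w.
    rewrite -(cvg_lim (@Rhausdorff R) (hg w)).
    apply: (@nondecreasing_cvgn_le _ (fun k => h k w)); last exact/cvg_ex/ex_intro/hg.
    by move=> a b ab; exact: (lefP _ _ (nd_nnsfun_approx measurableT mg ab)).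
  have h0 k w : 0 <= h k w by [].
  (* Since 0 <= [h k] <= [g], the differences are dominated by [g] itself. *)
  have Lc : L (h k) @[k --> \oo] --> L g.
    apply: (L_cvg (h := g)) => //; first by move=> k; case: (good_nnsfun (h k)).
    by move=> k w; rewrite ler_norml; have := hle k w; have := h0 k w; lra.
  have {}Lc : (L (h k))%:E @[k --> \oo] --> (L g)%:E.
    by apply: cvg_EFin => //; exact: nearW.
  have [] := @dominated_convergence _ _ _ P setT measurableT
    (fun k w => (h k w * y w)%:E) (fun w => (g w * y w)%:E)
    (fun w => `|(g w * y w)%:E|%E).
  - by move=> k; case: (good_nnsfun (h k)) => _ /integrableP[].
  - by case/integrableP : ig.
  - apply: aeW => w _; apply: cvg_EFin; first exact: nearW.
    by apply: cvgM; [exact: hg|exact: cvg_cst].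
  - exact: integrable_abse.
  - apply: aeW => w k _ /=; rewrite lee_fin !normrM ler_wpM2r//.
    by rewrite !ger0_norm.
  move=> _ _ Ic; have LE : (fun k => (L (h k))%:E) =
      (fun k => \int[P]_w (h k w * y w)%:E)%E.
    by apply/funext => k; case: (good_nnsfun (h k)).
  rewrite LE in Lc; exact: (cvg_unique _ Lc Ic).
move=> g fg ig.
(* Both parts are at most |g|, hence inherit finite norms and integrability against [y]. The factor
   -1 puts the decomposition in the shape of [good_lin]. *)
pose gp w := Num.max (g w) 0; pose gn w := Num.max (- g w) 0.
have gE : g = (fun w => -1 * gn w + gp w).
  by apply/funext => w; rewrite /gp /gn !maxEle; case: ifP; case: ifP; lra.
have pn f : (forall w, 0 <= f w <= `|g w|) -> measurable_fun setT f -> good y f.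
  move=> fle mf; apply: good_ge0; first by move=> w; case/andP: (fle w).
    apply: finite_norms_le fg _ => // w; have /andP[f0 fg'] := fle w.
    by rewrite ger0_norm.
  apply: le_integrable ig => //.
    by apply/measurable_EFinP; exact: measurable_funM.
  move=> w _ /=; have /andP[f0 fg'] := fle w.
  by rewrite lee_fin !normrM ler_wpM2r// ger0_norm.
have [_ _ <-] : good y g; last by [].
rewrite gE; apply: good_lin; apply: pn.
- by move=> w; rewrite /gn le_max lexx orbT ge_max -normrN ler_norm normr_ge0.
- by apply: measurable_maxr => //; apply: measurableT_comp => //; exact: fg.1.
- by move=> w; rewrite /gp le_max lexx orbT ge_max ler_norm normr_ge0.
- by apply: measurable_maxr => //; exact: fg.1.
Qed.

End representation.
End finite_norms.

(** * Bounded functionals on the intersection space *)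

Lemma ae_eq_integrable d (T : measurableType d) (R : realType)
    (mu : {measure set T -> \bar R}) (f g : T -> \bar R) :
  measurable_fun setT g -> f = g %[ae mu] ->
  mu.-integrable setT f -> mu.-integrable setT g.
Proof.
move=> mg fg /integrableP[mf foo]; apply/integrableP; split => //.
rewrite (ae_eq_integral (abse \o f)) //.
- exact: measurableT_comp.
- exact: measurableT_comp.
- by apply: filterS fg => w /(_ I) /= -> _.
Qed.

Section riesz.
Context d (T : measurableType d) (R : realType) (P : probability T R) (n : nat).
Context (S : set R) (S1 : S `<=` `[1, +oo[).
Local Notation U := (Uspace P n S1).
Implicit Types u v : T -> 'rV[R]_n.

Definition finite_norms_rv u := u \in @random_vector _ T R n /\
  finite_norms P S (fun w => enorm (u w)).

Lemma finite_norms_rv_capL u : finite_norms_rv u -> toL0 P u \in capL S1.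
Proof.
move=> [mu fu]; apply/capLP => q Sq.
have q0 := lt_le_trans ltr01 (exponent_ge1 S1 Sq).
by rewrite /Lp/= Lpnorm_toL0//; exact: fu.2.
Qed.

Lemma finite_norms_rv_lin a u v : finite_norms_rv u -> finite_norms_rv v ->
  finite_norms_rv (fun w => a *: u w + v w).
Proof.
move=> [mu fu] [mv fv].
have muv : (fun w => a *: u w + v w) \in @random_vector _ T R n.
  by have [_] := @random_vector_submod _ T R n; exact.
split => //; apply: finite_norms_le (finite_norms_lin S1 `|a| fu fv) _ => //.
  exact: random_vector_measurable_enorm.
move=> w; rewrite (ger0_norm (enorm_ge0 _)).
rewrite [leRHS]ger0_norm ?addr_ge0 ?mulr_ge0 ?enorm_ge0//.
by rewrite -enormZ enormD.
Qed.

Lemma finite_norms_rvZ (g : T -> R) (c : 'rV[R]_n) : finite_norms P S g ->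
  finite_norms_rv (fun w => g w *: c).
Proof.
move=> fg.
have mgc : (fun w => g w *: c) \in @random_vector _ T R n.
  by apply: random_vectorZ; [exact: fg.1|exact: random_vector_cst].
have fcg := finite_norms_lin S1 (enorm c) fg (finite_norms_cst P S1 0).
split => //; apply: finite_norms_le fcg _ => //.
  exact: random_vector_measurable_enorm.
move=> w; rewrite /= addr0 normrM !(ger0_norm (enorm_ge0 _)).
by rewrite enormZ mulrC.
Qed.

Lemma finite_norms_rv_bounded u M : u \in @random_vector _ T R n ->
  (forall w, enorm (u w) <= M) -> finite_norms_rv u.
Proof.
move=> mu uM; split => //; apply: (@finite_norms_bounded _ _ _ P S S1 _ M).
  exact: random_vector_measurable_enorm.
by move=> w; rewrite ger0_norm// enorm_ge0.
Qed.

Lemma finite_norms_coord u i : finite_norms_rv u ->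
  finite_norms P S (fun w => u w 0 i).
Proof.
move=> [mu fu]; apply: finite_norms_le fu _ => //.
  by move/random_vectorP : mu; exact.
by move=> w; rewrite [leRHS]ger0_norm ?enorm_ge0// normr_coord_le_enorm.
Qed.

Lemma finite_norms_rv_Uspace (u : U) : finite_norms_rv (L0_fun (Uval u)).
Proof.
split; first exact: random_vector_L0.
split; first exact: measurable_enorm.
by move=> q Sq; exact: Uspace_Lp.
Qed.

Context (q C : R) (Sq : S q) (C0 : 0 <= C) (f : U -> R).
Hypothesis f_lin : forall a (u v : U), f (a *: u + v) = a * f u + f v.
Hypothesis f_bound : forall u : U, `|f u| <= C * Unorm q u.

Let q1 : 1 <= q. Proof. exact: (exponent_ge1 S1 Sq). Qed.
Let q0 : 0 < q. Proof. exact: lt_le_trans ltr01 q1. Qed.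

(** [f] read on functions. It is meaningful under [finite_norms_rv]; elsewhere the defaults of
    [toL0] and [toU] make it [f 0]. *)
Let F u := f (toU S1 (toL0 P u)).

Let F_lin a u v : finite_norms_rv u -> finite_norms_rv v ->
  F (fun w => a *: u w + v w) = a * F u + F v.
Proof.
move=> fu fv; rewrite /F toL0_lin; [|exact: fu.1|exact: fv.1].
by rewrite toU_lin//; exact: finite_norms_rv_capL.
Qed.

Let F_bound u : finite_norms_rv u ->
  (`|F u|%:E <= C%:E * 'N[P]_q%:E[EFin \o (fun w => enorm (u w))])%E.
Proof.
move=> fu; have := f_bound (toU S1 (toL0 P u)); rewrite -lee_fin EFinM.
move=> /le_trans; apply; rewrite Unorm_EFin// toUK ?finite_norms_rv_capL//.
by rewrite Lpnorm_toL0//; exact: fu.1.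
Qed.

Let F_Uspace (u : U) : F (L0_fun (Uval u)) = f u.
Proof.
rewrite /F (_ : toL0 P _ = Uval u) ?UvalK//; apply: L0_ae_eq.
exact/toL0E/random_vector_L0.
Qed.

(** The scalar representation is applied to [g |-> F (g e_i)] for each coordinate, and the densities
    are assembled into one vector; u is then expanded in the canonical basis. *)
Let density : exists Y : L0 P n,
  (forall i, P.-integrable setT (EFin \o (fun w => Y w 0 i))) /\
  forall u, finite_norms_rv u ->
    (forall i, P.-integrable setT (EFin \o (fun w => u w 0 i * Y w 0 i))) ->
    (F u)%:E = (\int[P]_w (dotp (u w) (Y w))%:E)%E.
Proof.
pose L i (g : T -> R) := F (fun w => g w *: delta_mx 0 i).
have L_lin i a g h : finite_norms P S g -> finite_norms P S h ->
    L i (fun w => a * g w + h w) = a * L i g + L i h.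
  move=> fg fh; rewrite /L -F_lin; [|exact: finite_norms_rvZ..].
  by congr F; apply/funext => w; rewrite scalerDl scalerA.
have L_bound i g : finite_norms P S g ->
    (`|L i g|%:E <= C%:E * 'N[P]_q%:E[EFin \o g])%E.
  move=> fg; apply: le_trans (F_bound (finite_norms_rvZ _ fg)) _.
  rewrite lee_wpmul2l ?lee_fin//; apply: le_Lnorm_norm => //.
  - by apply: random_vector_measurable_enorm; exact: (finite_norms_rvZ _ fg).1.
  - exact: fg.1.
  - by move=> w; rewrite enormZ enorm_delta mulr1 normr_id.
have [y hy] := choice (fun i => representation S1 Sq C0 (@L_lin i) (@L_bound i)).
pose yv w : 'rV[R]_n := \row_i y i w.
have myv : yv \in @random_vector _ T R n.
  apply/random_vectorP => i; rewrite (_ : (fun w => _) = y i).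
    by case: (hy i).
  by apply/funext => w; rewrite mxE.
exists (toL0 P yv).
have aeY i : \forall w \ae P, toL0 P yv w 0 i = y i w.
  by have := toL0E P myv; apply: filterS => w /(_ I) ->; rewrite mxE.
(* The representative of the class agrees with the vector of densities only almost everywhere, so
   integrability and integrals have to be transferred. *)
have aeI i (g : T -> R) : measurable_fun setT g ->
    P.-integrable setT (EFin \o (fun w => g w * toL0 P yv w 0 i)) ->
    P.-integrable setT (EFin \o (fun w => g w * y i w)) /\
    (\int[P]_w (g w * toL0 P yv w 0 i)%:E = \int[P]_w (g w * y i w)%:E)%E.
  move=> mg ig; have my : measurable_fun setT (fun w => (g w * y i w)%:E).
    by apply/measurable_EFinP; apply: measurable_funM => //; case: (hy i).
  have E : ae_eq P setT (fun w => (g w * toL0 P yv w 0 i)%:E)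
      (fun w => (g w * y i w)%:E).
    by have := aeY i; apply: filterS => w + _ => ->.
  split; last by apply: ae_eq_integral => //; case/integrableP : ig.
  exact: (ae_eq_integrable my E ig).
split.
  move=> i; have [myi iyi _] := hy i; apply: ae_eq_integrable iyi.
    by apply/measurable_EFinP; exact: L0_funP.
  by have := aeY i; apply: filterS => w /= -> _.
move=> u fu iu.
(* Partial expansions along a list of coordinates, so that linearity is used one coordinate at a
   time. *)
pose part r w := \sum_(i <- r) (u w 0 i *: (delta_mx 0 i : 'rV[R]_n)).
have main r : [/\ finite_norms_rv (part r),
    P.-integrable setT (fun w => (\sum_(i <- r) u w 0 i * toL0 P yv w 0 i)%:E) &
    (F (part r))%:E =
      (\int[P]_w (\sum_(i <- r) u w 0 i * toL0 P yv w 0 i)%:E)%E].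
  elim: r => [|i r [fr ir Fr]].
    have E0 : part [::] = (fun=> 0 *: (0 : 'rV[R]_n)).
      by apply/funext => w; rewrite /part big_nil scaler0.
    have I0 : (fun w => (\sum_(i <- [::]) u w 0 i * toL0 P yv w 0 i)%:E) = cst 0%E.
      by apply/funext => w; rewrite big_nil.
    have f0 : finite_norms_rv (part [::]).
      by rewrite E0; exact: (finite_norms_rvZ _ (finite_norms_cst P S1 0)).
    split => //; first by rewrite I0; exact: integrable0.
    (* [F] of the zero function is 0 by linearity: [-1 * F + F]. *)
    rewrite I0 integral0; congr _%:E; have := F_lin (-1) f0 f0.
    rewrite mulN1r addNr => <-; congr F.
    by apply/funext => w; rewrite E0 !scaler0 addr0.
  have fi := finite_norms_coord i fu.
  have [iui Eui] := aeI i _ fi.1 (iu i).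
  have E1 : part (i :: r) = (fun w => 1 *: (u w 0 i *: delta_mx 0 i) + part r w).
    by apply/funext => w; rewrite /part big_cons scale1r.
  have E2 : (fun w => (\sum_(j <- i :: r) u w 0 j * toL0 P yv w 0 j)%:E) =
      (fun w => (u w 0 i * toL0 P yv w 0 i)%:E +
                (\sum_(j <- r) u w 0 j * toL0 P yv w 0 j)%:E)%E.
    by apply/funext => w; rewrite big_cons EFinD.
  split.
  - rewrite E1; apply: finite_norms_rv_lin => //; exact: finite_norms_rvZ.
  - rewrite E2; apply: integrableD => //; exact: iu.
  - rewrite E1 F_lin//; last exact: finite_norms_rvZ.
    rewrite mul1r EFinD Fr -/(L i (fun w => u w 0 i)).
    have [_ _ ->] := hy i => //; rewrite -Eui -integralD//; last exact: iu.
    by apply: eq_integral => w _; rewrite big_cons EFinD.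
have [_ _] := main (index_enum 'I_n).
rewrite (_ : part _ = u)//.
by apply/funext => w; rewrite [RHS]row_sum_delta.
Qed.

(** * Bound on the density in the conjugate space *)

Section density_norm.
Context (Y : L0 P n).
Hypothesis iY : forall i, P.-integrable setT (EFin \o (fun w => Y w 0 i)).
Hypothesis FY : forall u, finite_norms_rv u ->
  (forall i, P.-integrable setT (EFin \o (fun w => u w 0 i * Y w 0 i))) ->
  (F u)%:E = (\int[P]_w (dotp (u w) (Y w))%:E)%E.

Let E w := enorm (Y w).
Let E0 w : 0 <= E w. Proof. exact: enorm_ge0. Qed.
Let mE : measurable_fun setT E. Proof. exact: measurable_enorm. Qed.

(* Test functions are bounded multiples of [Y]; their pairing with [Y] is
   then integrable because the coordinates of [Y] are. *)
Let test_bound (g : T -> R) (M : R) : measurable_fun setT g ->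
  (forall w, `|g w| * E w <= M) ->
  (\int[P]_w (g w * E w ^+ 2)%:E <=
    C%:E * 'N[P]_q%:E[EFin \o (fun w => g w * E w)%R])%E /\
  (\int[P]_w (g w * E w ^+ 2)%:E)%E \is a fin_num.
Proof.
move=> mg gM; pose u w := g w *: Y w.
have uE w : enorm (u w) = `|g w| * E w by rewrite enormZ.
have mu : u \in @random_vector _ T R n.
  by apply: random_vectorZ => //; exact: random_vector_L0.
have fu : finite_norms_rv u.
  by apply: (@finite_norms_rv_bounded _ M) => // w; rewrite uE.
rewrite (_ : (\int[P]_w (g w * E w ^+ 2)%:E)%E = (F u)%:E).
  split => //; apply: le_trans (_ : (`|F u|%:E <= _)%E).
    by rewrite lee_fin ler_norm.
  apply: le_trans (F_bound fu) _; rewrite lee_wpmul2l ?lee_fin//.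
  apply: le_Lnorm_norm => //.
  - exact: random_vector_measurable_enorm.
  - exact: measurable_funM.
  - by move=> w; rewrite uE !normrM normr_id.
rewrite FY//; last first.
  move=> i; have iM := integrableZl measurableT `|M| (integrable_abse (iY i)).
  apply: le_integrable iM => //.
    apply/measurable_EFinP; apply: measurable_funM; last exact: L0_funP.
    by have /random_vectorP := mu; exact.
  move=> w _; rewrite /= lee_fin !normrM !normr_id ler_wpM2r//.
  apply: le_trans (normr_coord_le_enorm _ _) _.
  by rewrite uE (le_trans (gM w))// ler_norm.
by apply: eq_integral => w _; rewrite dotpZl -enorm_sqr.
Qed.

Let mset_gt (c : R) : measurable [set w | c < E w].
Proof.
rewrite (_ : [set _ | _] = E @^-1` `]c, +oo[%classic).
  by rewrite -[X in measurable X]setTI; exact: mE.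
by apply/seteqP; split => w /=; rewrite in_itv/= andbT.
Qed.

Let mset_le (c : R) : measurable [set w | E w <= c].
Proof.
rewrite (_ : [set _ | _] = ~` [set w | c < E w]); first exact: measurableC.
by apply/seteqP; split => w /=; rewrite leNgt => /negP.
Qed.

(** On [A], where |Y| > C, the test yields that the integral of |Y| over [A] is at most C P(A). The
    nonnegative function [h], equal to |Y| - C on [A] and 0 off it, thus has integral 0 and vanishes
    almost everywhere, so [A] is null. *)
Let density_Lp_pinfty : q = 1 -> Lp +oo%E Y.
Proof.
move=> qE; apply/Lp_pinftyP; exists C.
pose A := [set w | C < E w].
have mA : measurable_fun setT (\1_A : T -> R)
  by apply: measurable_indic; exact: mset_gt.
have mAV : measurable_fun setT (fun w => \1_A w * (E w)^-1).
  apply: measurable_funM => //.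
  rewrite (_ : (fun w => _) = (fun w => E w `^ (-1))).
    exact: (measurableT_comp (measurable_powR _)).
  by apply/funext => w; rewrite powR_inv1.
(* On [A] the norm exceeds [C >= 0] and can be cancelled; off [A] the indicator hides the value of
   the inverse at 0. *)
have AE w : \1_A w * (E w)^-1 * E w = \1_A w.
  rewrite indicE; have [/set_mem/= wA|_] := boolP (w \in A); last by rewrite !mul0r.
  by rewrite mul1r mulVf// gt_eqF// (le_lt_trans C0).
have [|hle hfin] := @test_bound _ 1 mAV.
  move=> w; rewrite ger0_norm ?AE; last by rewrite mulr_ge0 ?invr_ge0// indicE.
  by rewrite indicE; case: (_ \in _).
have EE : (\int[P]_w (\1_A w * (E w)^-1 * E w ^+ 2)%:E =
    \int[P]_w (\1_A w * E w)%:E)%E.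
  by apply: eq_integral => w _; rewrite expr2 mulrA AE.
rewrite EE in hle hfin.
have {}hle : (\int[P]_w (\1_A w * E w)%:E <= \int[P]_w (C * \1_A w)%:E)%E.
  apply: le_trans hle _.
  rewrite (_ : (\int[P]_w (C * \1_A w)%:E = C%:E * \int[P]_w (\1_A w)%:E)%E); last first.
    under eq_integral do rewrite EFinM.
    by rewrite ge0_integralZl//; exact/measurable_EFinP.
  rewrite lee_wpmul2l ?lee_fin// qE Lnorm1.
  rewrite le_eqVlt; apply/orP; left; apply/eqP; apply: eq_integral => w _ /=.
  by rewrite AE ger0_norm.
pose h w := \1_A w * E w - C * \1_A w.
have i1 : P.-integrable setT (EFin \o (fun w => \1_A w * E w)).
  apply/integrableP; split; first by apply/measurable_EFinP; exact: measurable_funM.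
  rewrite (_ : (\int[P]_w _)%E = (\int[P]_w (\1_A w * E w)%:E)%E).
    by rewrite ltey_eq hfin.
  by apply: eq_integral => w _ /=; rewrite ger0_norm// mulr_ge0.
have i2 : P.-integrable setT (EFin \o (fun w => C * \1_A w)).
  have iC : P.-integrable setT (EFin \o cst C).
    exact: finite_measure_integrable_cst.
  apply: le_integrable iC => //.
    by apply/measurable_EFinP; exact: measurable_funM.
  move=> w _ /=; rewrite lee_fin normrM ler_piMr// indicE.
  by case: (_ \in _); rewrite /= ?normr1 ?normr0.
have mh : measurable_fun setT h by apply: measurable_funB; exact: measurable_funM.
have h0 w : 0 <= h w.
  rewrite /h indicE; have [/set_mem/= wA|_] := boolP (w \in A).
    by rewrite mul1r mulr1 subr_ge0 ltW.
  by rewrite mul0r mulr0 subr0.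
have : (\int[P]_w `|(h w)%:E| = 0)%E.
  apply/eqP; rewrite eq_le integral_ge0 ?andbT//.
  rewrite (_ : (\int[P]_w _)%E =
      (\int[P]_w ((\1_A w * E w)%:E - (C * \1_A w)%:E))%E).
    by rewrite integralB_EFin// sube_le0.
  by apply: eq_integral => w _; rewrite gee0_abs ?lee_fin// -EFinB.
move=> /(ae_eq_integral_abs P measurableT _).1 h_ae.
have {h_ae}: \forall w \ae P, setT w -> (h w)%:E = 0%E.
  by apply: h_ae; exact/measurable_EFinP.
apply: filterS => w /(_ I)[]; rewrite /h indicE.
have [_|/negP wA] := boolP (w \in A); first by rewrite -/(E w) /= mul1r mulr1; lra.
by move=> _; rewrite leNgt; apply/negP => Cw; apply: wA; rewrite inE.
Qed.

(** Let I be the integral of |Y|^p over |Y| <= m. As [(p - 1) * q = p], the test vector has q-norm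
    I^(1/q), while its pairing with Y is I. The bound on [F] reads I <= C I^(1/q), that is I^(1/p)
    <= C. *)
Let density_Lp_conjugate : 1 < q -> Lp (q / (q - 1))%:E Y.
Proof.
move=> q1'; set p := q / (q - 1).
have qm : 0 < q - 1 by lra.
have p1E : p - 1 = (q - 1)^-1 by rewrite /p; field; rewrite gt_eqF.
have p1 : 0 < p - 1 by rewrite p1E invr_gt0.
have p0 : 0 < p by lra.
have pq1 : p^-1 + q^-1 = 1 by rewrite /p; field; rewrite !gt_eqF.
have ppq : (p - 1) * q = p by rewrite p1E /p mulrC.
pose g (m : nat) w := \1_[set w | E w <= m%:R] w * E w `^ (p - 1 - 1).
have gE m w : g m w * E w = \1_[set w | E w <= m%:R] w * E w `^ (p - 1).
  by rewrite /g -mulrA (mulrC _ (E w)) mulr_powRB1.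
have gE2 m w : g m w * E w ^+ 2 = \1_[set w | E w <= m%:R] w * E w `^ p.
  by rewrite expr2 mulrA gE -mulrA (mulrC _ (E w)) mulr_powRB1.
have mI m : measurable_fun setT (\1_[set w | E w <= m%:R] : T -> R).
  by apply: measurable_indic; exact: mset_le.
have mg m : measurable_fun setT (g m).
  by apply: measurable_funM => //; exact: (measurableT_comp (measurable_powR _)).
have g0 m w : 0 <= g m w by rewrite mulr_ge0 ?powR_ge0// indicE.
pose h m w := \1_[set w | E w <= m%:R] w * E w.
have mh m : measurable_fun setT (h m) by exact: measurable_funM.
have hle m : ('N[P]_p%:E[EFin \o h m] <= C%:E)%E.
  have [|hle hfin] := @test_bound _ (m%:R `^ (p - 1)) (mg m).
    move=> w; rewrite ger0_norm// gE indicE.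
    have [/set_mem/= wm|_] := boolP (_ \in _); last by rewrite mul0r powR_ge0.
    by rewrite mul1r ge0_ler_powR ?nnegrE ?(ltW p1).
  rewrite -(fineK hfin) in hle; move: hle.
  set I := fine _ => hle.
  have I0 : 0 <= I.
    by apply/fine_ge0/integral_ge0 => w _; rewrite lee_fin mulr_ge0// sqr_ge0.
  have IE : (\int[P]_w (\1_[set w | E w <= m%:R] w * E w `^ p)%:E)%E = I%:E.
    by rewrite /I fineK//; apply: eq_integral => w _; rewrite gE2.
  have indX (r : R) (w : T) : 0 < r ->
      \1_[set w | E w <= m%:R] w `^ r = \1_[set w | E w <= m%:R] w :> R.
    move=> r0; rewrite indicE; case: (_ \in _); rewrite ?powR1//.
    by rewrite powR0// gt_eqF.
  have Nle : ('N[P]_q%:E[EFin \o (fun w => g m w * E w)%R] <= (I `^ q^-1)%:E)%E.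
    rewrite Lnorm_le_EFin ?powR_ge0// -powRrM mulVf ?gt_eqF// powRr1// -IE.
    rewrite le_eqVlt; apply/orP; left; apply/eqP; apply: eq_integral => w _.
    rewrite /= (ger0_norm (mulr_ge0 (g0 m w) (E0 w))) gE.
    rewrite powRM ?powR_ge0//.
    by rewrite indX// -powRrM ppq.
  have {}hle : I <= C * I `^ q^-1.
    rewrite -lee_fin EFinM; apply: le_trans hle _.
    by rewrite lee_wpmul2l ?lee_fin.
  rewrite Lnorm_le_EFin//.
  rewrite (_ : (\int[P]_w _)%E = I%:E); last first.
    rewrite -IE; apply: eq_integral => w _; rewrite /h ger0_norm; last first.
      by rewrite mulr_ge0// indicE.
    by rewrite powRM ?indX// indicE.
  (* I is a real number thanks to [hfin]; once it is nonzero, division by I^(1/q) is legitimate. *)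
  rewrite lee_fin; have [->|In0] := eqVneq I 0; first exact: powR_ge0.
  have Ipos : 0 < I by rewrite lt_neqAle eq_sym In0.
  have IC : I `^ p^-1 <= C.
    rewrite -(ler_pM2r (powR_gt0 q^-1 Ipos)) -powRD ?pq1 ?powRr1//.
    by apply/implyP.
  have -> : I = (I `^ p^-1) `^ p by rewrite -powRrM mulVf ?gt_eqF// powRr1.
  by rewrite ge0_ler_powR ?nnegrE ?powR_ge0 ?(ltW p0).
(* The bound is uniform in m, and at each point the truncations of [E] are eventually equal to
   [E]. *)
have := @Lnorm_fatou _ _ _ P h E p C p0 C0 mh mE _ hle.
move=> /(_ _)/le_lt_trans; apply; last exact: ltry.
apply: aeW => w; apply: cvg_near_cst.
have [m hm] : exists m : nat, E w <= m%:R.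
  by exists (Num.trunc (E w)).+1; rewrite ltW// truncnS_gt.
exists m => // k /= mk; rewrite /h indicE mem_set ?mul1r//=.
by rewrite (le_trans hm)// ler_nat.
Qed.

Lemma density_Lp : Lp (hoelder_conjugate q%:E) Y.
Proof.
have [qE|qn1] := eqVneq q 1.
  by rewrite {1}qE hoelder_conjugate1; exact: density_Lp_pinfty.
have q1' : 1 < q by rewrite lt_neqAle eq_sym qn1 q1.
rewrite /hoelder_conjugate/= eqe gt_eqF// inver gt_eqF ?subr_gt0// -EFinM.
exact: density_Lp_conjugate.
Qed.

End density_norm.

(** Now that Y is in the conjugate space, |u_i Y_i| <= |u| |Y| and Hölder's inequality supply the
    integrability premise of [density] for every element of the space. *)
Lemma riesz_representation : exists2 Y : L0 P n,
  Lp (hoelder_conjugate q%:E) Y & forall u : U, f u = pairing (Uval u) Y.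
Proof.
have [Y [iY FY]] := density; have Yq := density_Lp iY FY; exists Y => // u.
have fu := finite_norms_rv_Uspace u.
rewrite -F_Uspace; apply: EFin_inj; rewrite FY//; last first.
  move=> i; have uq : Lp q%:E (Uval u) by exact: Uspace_Lp.
  apply/integrableP; split.
    by apply/measurable_EFinP; apply: measurable_funM; exact: L0_funP.
  have := Lnorm_hoelder P q1 (measurable_enorm (Uval u)) (measurable_enorm Y).
  move=> h; apply: (@le_lt_trans _ _ (Lpnorm q%:E (Uval u) *
      Lpnorm (hoelder_conjugate q%:E) Y)%E); last first.
    by rewrite lte_mul_pinfty// ?Lnorm_ge0 ?ge0_fin_numE ?Lnorm_ge0.
  apply: le_trans h; rewrite Lnorm1; apply: ge0_le_integral => //.
  - apply: measurableT_comp => //.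
    by apply/measurable_EFinP; apply: measurable_funM; exact: L0_funP.
  - apply/measurable_EFinP; apply: measurableT_comp => //.
    by apply: measurable_funM; exact: measurable_enorm.
  - move=> w _ /=; rewrite lee_fin normrM [leRHS]ger0_norm; last first.
      by rewrite mulr_ge0 ?enorm_ge0.
    by rewrite ler_pM// normr_coord_le_enorm.
have := dotp_integrable q1 (Uspace_Lp u Sq) Yq.
move=> /(integrable_fin_num measurableT) h.
by rewrite /pairing unlock fineK.
Qed.

End riesz.

(** * Duality *)

Section pairing_properties.
Context d (T : measurableType d) (R : realType) (P : probability T R) (n : nat).
Context (S : set R) (S1 : S `<=` `[1, +oo[).
Local Notation U := (Uspace P n S1).
Implicit Types (u v : U) (y z : L0 P n).

Lemma cupL_integrable u y : cupL P n S y ->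
  P.-integrable setT (EFin \o (fun w => dotp (u w) (y w))).
Proof.
move=> [q Sq yq]; apply: dotp_integrable (exponent_ge1 S1 Sq) _ yq.
exact: Uspace_Lp.
Qed.

(** The union is a vector space because it is a chain: of two exponents the larger has the smaller
    conjugate, hence, on a probability space, the larger space, which contains both vectors. *)
Lemma cupL_lin a y z : cupL P n S y -> cupL P n S z -> cupL P n S (a *: y + z).
Proof.
have hc q : S q -> (1 <= hoelder_conjugate q%:E)%E.
  by move=> Sq; apply: hoelder_conj_ge1; rewrite lee_fin (exponent_ge1 S1 Sq).
have up p q x : S p -> S q -> p <= q -> Lp (hoelder_conjugate p%:E) x ->
    @Lp _ _ _ P n (hoelder_conjugate q%:E) x.
  move=> Sp Sq pq; apply: Lp_anti; first exact: hc.
  by apply: hoelder_conjugate_anti => //; exact: (exponent_ge1 S1 Sp).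
move=> [p Sp yp] [q Sq zq]; have [pq|/ltW qp] := leP p q.
  exists q => //; apply: Lp_submod_extended zq; first exact: hc.
  exact: up yp.
exists p => //; apply: Lp_submod_extended yp _; first exact: hc.
exact: up zq.
Qed.

Lemma pairing_EFin u y : cupL P n S y ->
  (pairing u y)%:E = (\int[P]_w (dotp (u w) (y w))%:E)%E.
Proof.
move=> yS; rewrite /pairing unlock fineK//.
exact: (integrable_fin_num measurableT (cupL_integrable u yS)).
Qed.

Lemma pairing_lin_r u a y z : cupL P n S y -> cupL P n S z ->
  pairing u (a *: y + z) = a * pairing u y + pairing u z.
Proof.
move=> yS zS; apply: EFin_inj; rewrite EFinD EFinM !pairing_EFin//; last exact: cupL_lin.
have iy := cupL_integrable u yS; have iz := cupL_integrable u zS.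
rewrite -integralZl// -integralD//; last exact: integrableZl.
apply: ae_eq_integral => //.
- by apply/measurable_EFinP; exact: measurable_dotp.
- by apply/measurable_EFinP; apply: measurable_funD;
    [apply: measurable_funM => //|]; exact: measurable_dotp.
have := L0Z a y; have := L0D (a *: y) z.
apply: filterS2 => w /(_ I) E1 /(_ I) E2 _.
by rewrite E1 E2 dotpC dotpDl dotpZl EFinD EFinM !(dotpC (u w)).
Qed.

Lemma pairing_lin_l a u v y : cupL P n S y ->
  pairing (Uval (a *: u + v)) y = a * pairing u y + pairing v y.
Proof.
move=> yS; apply: EFin_inj; rewrite EFinD EFinM !pairing_EFin//.
have iu := cupL_integrable u yS; have iv := cupL_integrable v yS.
rewrite -integralZl// -integralD//; last exact: integrableZl.
apply: ae_eq_integral => //.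
- by apply/measurable_EFinP; exact: measurable_dotp.
- by apply/measurable_EFinP; apply: measurable_funD;
    [apply: measurable_funM => //|]; exact: measurable_dotp.
have := L0Z a (Uval u); have := L0D (a *: Uval u) (Uval v).
apply: filterS2 => w /(_ I) E1 /(_ I) E2 _.
by rewrite E1 E2 dotpDl dotpZl EFinD EFinM.
Qed.

Lemma pairing_le q u y : S q -> Lp (hoelder_conjugate q%:E) y ->
  `|pairing u y| <= fine (Lpnorm (hoelder_conjugate q%:E) y) * Unorm q u.
Proof.
move=> Sq yq; have yS : cupL P n S y by exists q.
rewrite mulrC -lee_fin EFinM Unorm_EFin// fineK; last first.
  by rewrite ge0_fin_numE ?Lnorm_ge0.
apply: le_trans (Lpnorm_dotp_hoelder u y (exponent_ge1 S1 Sq)).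
rewrite -abse_EFin pairing_EFin//.
by apply: le_abse_integral => //; apply/measurable_EFinP; exact: measurable_dotp.
Qed.

(* Testing against the coordinatewise signs of [y - z]. *)
Lemma pairing_inj y z : S !=set0 -> cupL P n S y -> cupL P n S z ->
  (forall u, pairing u y = pairing u z) -> y = z.
Proof.
move=> S0 yS zS yz; pose x : L0 P n := (-1) *: z + y.
have xS : cupL P n S x by exact: cupL_lin.
have x0 u : pairing u x = 0 by rewrite pairing_lin_r// yz mulN1r addNr.
suff xae : \forall w \ae P, forall i, x w 0 i = 0.
  apply: L0_ae_eq; have := L0Z (-1) z; have := L0D ((-1) *: z) y.
  apply: filterS3 xae => w x0w /(_ I) E1 /(_ I) E2 _; apply/rowP => i.
  have := x0w i; rewrite /x E1 mxE E2 mxE mulN1r => /eqP.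
  by rewrite addrC subr_eq0 => /eqP.
suff xi i : \forall w \ae P, x w 0 i = 0.
  by apply: filter_forall => i; exact: xi.
pose g w := x w 0 i * `|x w 0 i|^-1.
have mx : measurable_fun setT (fun w => x w 0 i) by exact: L0_funP.
have mg : measurable_fun setT g.
  apply: measurable_funM => //.
  rewrite (_ : (fun w => _) = (fun w => `|x w 0 i| `^ (-1))).
    exact: measurable_norm_powR.
  by apply/funext => w; rewrite powR_inv1.
have gx w : g w * x w 0 i = `|x w 0 i|.
  rewrite /g mulrAC -expr2 -real_normK ?num_real// expr2.
  by have [->|xn0] := eqVneq `|x w 0 i| 0; rewrite ?mulr0 ?mul0r// mulfK.
pose u w : 'rV[R]_n := g w *: delta_mx 0 i.
have mu : u \in @random_vector _ T R n.
  by apply: random_vectorZ => //; exact: random_vector_cst.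
have fu : finite_norms_rv P S u.
  apply: (@finite_norms_rv_bounded _ _ _ P n S S1 _ 1) => // w.
  rewrite enormZ enorm_delta mulr1 normrM normfV normr_id.
  by have [->|xn0] := eqVneq `|x w 0 i| 0; rewrite ?mul0r// divff.
have uS := finite_norms_rv_capL S1 fu.
have : (pairing (toU S1 (toL0 P u)) x)%:E = 0%E by rewrite x0.
rewrite pairing_EFin// toUK//.
rewrite (_ : (\int[P]_w _)%E = (\int[P]_w `|(x w 0 i)%:E|)%E); last first.
  apply: ae_eq_integral => //.
  - by apply/measurable_EFinP; exact: measurable_dotp.
  - apply: measurableT_comp => //; apply/measurable_EFinP; exact: L0_funP.
  - have := toL0E P mu; apply: filterS => w /(_ I) -> _.
    by rewrite dotpZl dotp_delta gx.
move=> /(ae_eq_integral_abs P measurableT _).1 h.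
have {h}: \forall w \ae P, setT w -> (x w 0 i)%:E = 0%E.
  by apply: h; apply/measurable_EFinP; exact: L0_funP.
by apply: filterS => w /(_ I)[].
Qed.

Lemma bounded_linear_continuous (f : U -> R^o) q C : S q -> 0 <= C ->
  linear f -> (forall u, `|f u| <= C * Unorm q u) -> continuous f.
Proof.
move=> Sq C0 f_lin fC u.
have uF : Filter (nbhs u) by exact: nbhs_filter.
apply/(@cvgrPdist_lt _ _ _ (nbhs u) uF) => e e0.
have C1 : 0 < C + 1 by rewrite ltr_wpDl.
have un : nbhs u
    [set v : U | forall p, p \in [:: q] -> Unorm p (v - u) < e / (C + 1)].
  exists [:: q]; first by move=> p; rewrite inE => /eqP ->.
  by exists (e / (C + 1)); rewrite ?divr_gt0.
apply: (@filterS _ (nbhs u) _ _ _ _ un) => v /= /(_ q (mem_head _ _)) h.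
have -> : f u - f v = - f (v - u).
  have := f_lin (-1) u v; rewrite scaleN1r [- u + v]addrC => ->.
  by rewrite scaleN1r opprD opprK.
rewrite normrN; apply: le_lt_trans (fC _) _.
move: h; rewrite ltr_pdivlMr// => h; apply: le_lt_trans h.
by rewrite mulrC ler_wpM2l ?Unorm_ge0// lerDl ler01.
Qed.

Lemma continuous_linear_bounded (f : U -> R^o) : S !=set0 ->
  linear f -> continuous f ->
  exists2 q, S q & exists2 C, 0 <= C & forall u, `|f u| <= C * Unorm q u.
Proof.
move=> [q0 Sq0] f_lin fc.
have fZ a u : f (a *: u) = a * f u.
  have f00 : f 0 = 0.
    by have := f_lin (-1) 0 0; rewrite scaler0 addr0 scaleN1r addNr.
  by have := f_lin a u 0; rewrite addr0 f00 addr0.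
have f0 : f 0 = 0 by rewrite -(scale0r (0 : U)) fZ mul0r.
have := fc 0 => /cvgrPdist_lt/(_ 1 ltr01).
rewrite f0 => -[F FS [e e0 Fe]].
(* The largest exponent of the finite set dominates its other norms. [q0] provides one when the set
   is empty. *)
have [q Sq qF] : exists2 q, S q & forall p, p \in F -> p <= q.
  elim: F FS {Fe} => [|p F IH] FS; first by exists q0.
  have [|q Sq qF] := IH; first by move=> r rF; apply: FS; rewrite inE rF orbT.
  have Sp : S p by apply: FS; rewrite mem_head.
  have [pq|/ltW qp] := leP p q.
    by exists q => // r; rewrite inE => /predU1P[->//|/qF].
  by exists p => // r; rewrite inE => /predU1P[->//|/qF/le_trans]; apply.
(* Rescaling u to norm [e / 2] puts it strictly inside the ball where |f| < 1, which gives the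
   constant [2 / e]. A vector of norm 0 cannot be rescaled, but it is 0. *)
exists q => //; exists (2 / e); first by rewrite divr_ge0// ltW.
move=> u; have [N0|N0] := eqVneq (Unorm q u) 0.
  by rewrite (Unorm_eq0 Sq N0) f0 normr0 mulr_ge0 ?Unorm_ge0 ?divr_ge0 ?ltW.
have Npos : 0 < Unorm q u by rewrite lt_neqAle eq_sym N0 Unorm_ge0.
pose c := e / 2 / Unorm q u.
have c0 : 0 < c by rewrite !divr_gt0.
have := Fe (c *: u); rewrite /= subr0 sub0r normrN fZ normrM gtr0_norm//.
have h p : p \in F -> Unorm p (c *: u) < e.
  move=> pF; have Sp := FS _ pF.
  rewrite UnormZ// gtr0_norm//; apply: (@le_lt_trans _ _ (c * Unorm q u)).
    by rewrite ler_wpM2l ?(ltW c0)// Unorm_le_exponent// qF.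
  by rewrite /c divfK//; lra.
move=> /(_ h); rewrite mulrC -ltr_pdivlMr// div1r /c => /ltW/le_trans; apply.
by rewrite !invf_div mulrC -mulrA (mulrC 2).
Qed.

End pairing_properties.

Theorem mainTheorem3 (d : measure_display) (T : measurableType d)
    (R : realType) (P : probability T R) (n : nat) (n1 : (1 <= n)%N)
    (S : set R) (S1 : S `<=` `[1, +oo[)
    (hS : exists2 s : nat -> R, nondecreasing_seq s & S = range s) :
  frechet_space (Uspace P n S1 : tvsType R) /\
  [/\ forall (u : Uspace P n S1) (y : L0 P n), cupL P n S y ->
        P.-integrable setT (EFin \o (fun w => dotp (u w) (y w))),
      forall (a : R) (y z : L0 P n), cupL P n S y -> cupL P n S z ->
        cupL P n S (a *: y + z) /\
        (forall u : Uspace P n S1,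
          pairing u (a *: y + z) = a * pairing u y + pairing u z) &
      set_bij (cupL P n S) (topological_dual (Uspace P n S1 : tvsType R))
        (fun (y : L0 P n) (u : Uspace P n S1) => pairing u y)].
Proof.
have [s _ Ss] := hS; split; first exact: frechet_Uspace Ss.
have S0 : S !=set0 by exists (s 0%N); rewrite Ss; exists 0%N.
split; first by move=> u y; exact: cupL_integrable.
  move=> a y z yS zS; split; first exact: cupL_lin.
  by move=> u; exact: pairing_lin_r.
split.
- move=> y yS; have f_lin : linear ((fun u : Uspace P n S1 => pairing u y) : _ -> R^o).
    by move=> a u v; exact: pairing_lin_l.
  split => //; have [q Sq yq] := yS.
  apply: (bounded_linear_continuous Sq _ f_lin); last first.
    by move=> u; exact: pairing_le.
  exact/fine_ge0/Lnorm_ge0.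
- move=> y z /set_mem yS /set_mem zS yz.
  apply: (@pairing_inj _ _ _ P n S S1 y z S0 yS zS) => u.
  exact: (congr1 (fun f => f u) yz).
- move=> f [f_lin fc].
  have [q Sq [C C0 fC]] := continuous_linear_bounded S0 f_lin fc.
  have [Y Yq fY] := riesz_representation Sq C0 f_lin fC.
  by exists Y; [exists q|apply/funext => u; rewrite fY].
Qed.
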